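(* Let $A$ and $B$ be rings, $V$ an $A$-$B$-bimodule, $U$ a $B$-$A$-bimodule, $\Lambda_{(0,0)}=\begin{pmatrix}A&V\\ U&B\end{pmatrix}$ the Morita ring with zero bimodule homomorphisms, $n\geqslant 1$ an integer, $\mathcal{C}_1,\mathcal{C}_2$ classes of left $A$-modules and $\mathcal{D}_1,\mathcal{D}_2$ classes of left $B$-modules. (1) Let $(\mathfrak{U}_{\mathcal{D}_1}^{\mathcal{C}_1},\mathfrak{J}_{\mathcal{D}_2}^{\mathcal{C}_2})$ be a left $n$-cotorsion pair in $\Lambda_{(0,0)}$-$\mathrm{Mod}$. Assume that $\mathrm{Ext}_A^i(V,\mathcal{C}_2)=0=\mathrm{Ext}_B^i(U,\mathcal{D}_2)$ for each $1\leqslant i\leqslant n$, $\mathrm{Ext}_A^1(\mathrm{Hom}_B(U,\mathcal{D}_2),\mathcal{C}_2)=0=\mathrm{Ext}_B^1(\mathrm{Hom}_A(V,\mathcal{C}_2),\mathcal{D}_2)$, $\mathrm{Hom}_A(V,\mathcal{C}_2)\subseteq\mathcal{D}_2$, $\mathrm{Hom}_B(U,\mathcal{D}_2)\subseteq\mathcal{C}_2$, and $(\mathcal{C}_2)_{n-1}^{\wedge}$ and $(\mathcal{D}_2)_{n-1}^{\wedge}$ are closed under extensions. Then $(\mathcal{C}_1,\mathcal{C}_2)$ and $(\mathcal{D}_1,\mathcal{D}_2)$ are left $n$-cotorsion pairs in $A$-$\mathrm{Mod}$ and $B$-$\mathrm{Mod}$, respectively. (2) Let $(\mathfrak{B}_{\mathcal{D}_1}^{\mathcal{C}_1},\mathfrak{U}_{\mathcal{D}_2}^{\mathcal{C}_2})$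 be a right $n$-cotorsion pair in $\Lambda_{(0,0)}$-$\mathrm{Mod}$. Assume that $\mathrm{Tor}_i^A(U,\mathcal{C}_1)=0=\mathrm{Tor}_i^B(V,\mathcal{D}_1)$ for each $1\leqslant i\leqslant n$, $\mathrm{Ext}_A^1(\mathcal{C}_1,V\otimes_B\mathcal{D}_1)=0=\mathrm{Ext}_B^1(\mathcal{D}_1,U\otimes_A\mathcal{C}_1)$, $V\otimes_B\mathcal{D}_1\subseteq\mathcal{C}_1$, $U\otimes_A\mathcal{C}_1\subseteq\mathcal{D}_1$, and $(\mathcal{C}_1)_{n-1}^{\vee}$ and $(\mathcal{D}_1)_{n-1}^{\vee}$ are closed under extensions. Then $(\mathcal{C}_1,\mathcal{C}_2)$ and $(\mathcal{D}_1,\mathcal{D}_2)$ are right $n$-cotorsion pairs in $A$-$\mathrm{Mod}$ and $B$-$\mathrm{Mod}$, respectively.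
   Context: Rings are associative with identity, modules are unitary, and $S$-$\mathrm{Mod}$ is the category of left $S$-modules. Classes of modules contain $0$ and are closed under isomorphisms. Vanishing and inclusion statements with classes as arguments are meant for all members of the classes (chosen independently). $\Lambda_{(0,0)}$ consists of matrices $\begin{pmatrix}a&v\\ u&b\end{pmatrix}$ with entrywise addition and $\begin{pmatrix}a_1&v_1\\ u_1&b_1\end{pmatrix}\begin{pmatrix}a_2&v_2\\ u_2&b_2\end{pmatrix}=\begin{pmatrix}a_1a_2&a_1v_2+v_1b_2\\ u_1a_2+b_1u_2&b_1b_2\end{pmatrix}$. A left $\Lambda_{(0,0)}$-module is identified with a tuple $(X,Y,f,g)$, where $X\in A$-$\mathrm{Mod}$, $Y\in B$-$\mathrm{Mod}$, $f:U\otimes_A X\to Y$ is $B$-linear, $g:V\otimes_B Y\to X$ is $A$-linear, $g(V\otimes_B f)=0$ and $f(U\otimes_A g)=0$; equivalently (by adjunction) with a tuple $[X,Y,f,g]$, where $f:X\to\mathrm{Hom}_B(U,Y)$ is $A$-linear, $g:Y\to\mathrm{Hom}_A(V,X)$ is $B$-linear, $\mathrm{Hom}_B(U,g)f=0$ and $\mathrm{Hom}_A(V,f)g=0$. Morphisms are pairs of linear maps compatible with the structure maps; exactness is componentwise. For a class $\mathcal{C}$ of left $A$-modules and a class $\mathcal{D}$ of left $B$-modules: $\mathfrak{U}_{\mathcal{D}}^{\mathcal{C}}$ is the class of $(X,Y,f,g)$ with $X\in\mathcal{C}$, $Y\in\mathcal{D}$; $\mathfrak{B}_{\mathcal{D}}^{\mathcal{C}}$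 is the class of $(X,Y,f,g)$ with $\mathrm{Coker}\,f\in\mathcal{D}$, $\mathrm{Coker}\,g\in\mathcal{C}$, and $V\otimes_B U\otimes_A X\xrightarrow{V\otimes_B f}V\otimes_B Y\xrightarrow{g}X$ and $U\otimes_A V\otimes_B Y\xrightarrow{U\otimes_A g}U\otimes_A X\xrightarrow{f}Y$ exact; $\mathfrak{J}_{\mathcal{D}}^{\mathcal{C}}$ is the class of $[X,Y,f,g]$ with $\mathrm{Ker}\,f\in\mathcal{C}$, $\mathrm{Ker}\,g\in\mathcal{D}$, and $X\xrightarrow{f}\mathrm{Hom}_B(U,Y)\xrightarrow{\mathrm{Hom}_B(U,g)}\mathrm{Hom}_B(U,\mathrm{Hom}_A(V,X))$ and $Y\xrightarrow{g}\mathrm{Hom}_A(V,X)\xrightarrow{\mathrm{Hom}_A(V,f)}\mathrm{Hom}_A(V,\mathrm{Hom}_B(U,Y))$ exact. For a class $\mathcal{C}$ of objects of an abelian category and $m\geqslant 0$: $\mathcal{C}_m^{\wedge}$ is the class of objects $A$ admitting an exact sequence $0\to C_k\to\cdots\to C_0\to A\to 0$ with all $C_i\in\mathcal{C}$ and some $k\leqslant m$; $\mathcal{C}_m^{\vee}$ is the class of objects $A$ admitting an exact sequence $0\to A\to C^0\to\cdots\to C^k\to 0$ with all $C^i\in\mathcal{C}$ and some $k\leqslant m$. A pair $(\mathcal{C},\mathcal{D})$ of classes of objects in an abelian category is a left $n$-cotorsion pair if (i) $\mathcal{C}$ is closed under direct summands, (ii) $\mathrm{Ext}^i(C,D)=0$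 for all $1\leqslant i\leqslant n$, $C\in\mathcal{C}$, $D\in\mathcal{D}$, and (iii) every object $A$ admits a short exact sequence $0\to K\to C\to A\to 0$ with $C\in\mathcal{C}$, $K\in\mathcal{D}_{n-1}^{\wedge}$. It is a right $n$-cotorsion pair if (i') $\mathcal{D}$ is closed under direct summands, (ii) holds, and (iii') every object $A$ admits a short exact sequence $0\to A\to D\to K\to 0$ with $D\in\mathcal{D}$, $K\in\mathcal{C}_{n-1}^{\vee}$. *)

(* Defs.v *)
From HB Require Import structures.
From mathcomp Require Import all_boot all_algebra boolp.

Set Implicit Arguments.
Unset Strict Implicit.
Unset Printing Implicit Defensive.

Import GRing.Theory.

Local Open Scope ring_scope.
Local Open Scope quotient_scope.

(* Rings are [pzRingType]s (associative, with identity, the zero ring         *)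
(* included), and left R-modules are [lmodType R]s.                           *)

(* A class of modules is an isomorphism-closed predicate containing 0.        *)
Definition module_class (R : pzRingType) (C : lmodType R -> Prop) : Prop :=
  (forall Z : lmodType R, (forall z : Z, z = 0) -> C Z) /\
  (forall (M N : lmodType R) (h : {linear M -> N}), bijective h -> C M -> C N).

(* Exactness of M -> N -> P at N.                                             *)
Definition exact (R : pzRingType) (M N P : lmodType R)
    (f : {linear M -> N}) (g : {linear N -> P}) : Prop :=
  forall y : N, g y = 0 <-> exists x : M, f x = y.

Definition short_exact (R : pzRingType) (K M N : lmodType R)
    (f : {linear K -> M}) (g : {linear M -> N}) : Prop :=
  [/\ injective f, exact f g & forall z : N, exists y : M, g y = z].

(* Kernels and cokernels are determined up to isomorphism; [C] is meant to be *)
(* isomorphism-closed.                                                        *)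
Definition kernel_in (R : pzRingType) (M N : lmodType R) (f : {linear M -> N})
    (C : lmodType R -> Prop) : Prop :=
  exists (K : lmodType R) (k : {linear K -> M}),
    [/\ injective k, exact k f & C K].

Definition cokernel_in (R : pzRingType) (M N : lmodType R)
    (f : {linear M -> N}) (C : lmodType R -> Prop) : Prop :=
  exists (Q : lmodType R) (q : {linear N -> Q}),
    [/\ (forall z : Q, exists y : N, q y = z), exact f q & C Q].

Definition projective (R : pzRingType) (P : lmodType R) : Prop :=
  forall (M N : lmodType R) (g : {linear M -> N}) (h : {linear P -> N}),
    (forall z : N, exists y : M, g y = z) ->
    exists k : {linear P -> M}, forall x : P, g (k x) = h x.

(* ... -> P 2 -> P 1 -> P 0 -> M -> 0, exact.                                 *)
Definition left_resolution (R : pzRingType) (M : lmodType R)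
    (P : nat -> lmodType R) (d : forall i, {linear P i.+1 -> P i})
    (e : {linear P 0 -> M}) : Prop :=
  [/\ forall x : M, exists p : P 0, e p = x,
      exact (d 0) e
    & forall i, exact (d i.+1) (d i)].

(* 0 -> M -> I 0 -> I 1 -> I 2 -> ..., exact.                                 *)
Definition right_resolution (R : pzRingType) (M : lmodType R)
    (I : nat -> lmodType R) (d : forall i, {linear I i -> I i.+1})
    (e : {linear M -> I 0}) : Prop :=
  [/\ injective e,
      exact e (d 0)
    & forall i, exact (d i) (d i.+1)].

(* Ext^i_R(M, N) = 0: the i-th cohomology of Hom_R(P, N) vanishes for every   *)
(* projective resolution P of M (all of them have the same cohomology).       *)
Definition Ext_eq0 (R : pzRingType) (i : nat) (M N : lmodType R) : Prop :=
  forall (P : nat -> lmodType R) (d : forall j, {linear P j.+1 -> P j})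
         (e : {linear P 0 -> M}),
    (forall j, projective (P j)) -> left_resolution d e ->
    match i with
    | 0 => forall h : {linear P 0 -> N},
        (forall x, h (d 0 x) = 0) -> forall x, h x = 0
    | j.+1 => forall h : {linear P j.+1 -> N},
        (forall x, h (d j.+1 x) = 0) ->
        exists k : {linear P j -> N}, forall x, h x = k (d j x)
    end.

(* The class C_m^wedge: the resolution is extended by zeros above degree k.   *)
Definition wedge (R : pzRingType) (C : lmodType R -> Prop) (m : nat)
    (M : lmodType R) : Prop :=
  exists (k : nat) (X : nat -> lmodType R)
         (d : forall i, {linear X i.+1 -> X i}) (e : {linear X 0 -> M}),
    [/\ (k <= m)%N, left_resolution d e,
        forall i, (i <= k)%N -> C (X i)
      & forall i, (k < i)%N -> forall x : X i, x = 0].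

(* The class C_m^vee.                                                         *)
Definition vee (R : pzRingType) (C : lmodType R -> Prop) (m : nat)
    (M : lmodType R) : Prop :=
  exists (k : nat) (X : nat -> lmodType R)
         (d : forall i, {linear X i -> X i.+1}) (e : {linear M -> X 0}),
    [/\ (k <= m)%N, right_resolution d e,
        forall i, (i <= k)%N -> C (X i)
      & forall i, (k < i)%N -> forall x : X i, x = 0].

Definition closed_under_extensions (R : pzRingType)
    (C : lmodType R -> Prop) : Prop :=
  forall (K M N : lmodType R) (f : {linear K -> M}) (g : {linear M -> N}),
    short_exact f g -> C K -> C N -> C M.

Definition closed_under_summands (R : pzRingType)
    (C : lmodType R -> Prop) : Prop :=
  forall (M N X : lmodType R) (h : {linear (M * N)%type -> X}),
    bijective h -> C X -> C M.

Definition left_cotorsion_pair (R : pzRingType) (n : nat)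
    (C D : lmodType R -> Prop) : Prop :=
  [/\ closed_under_summands C,
      forall i, (1 <= i <= n)%N -> forall X Y : lmodType R,
        C X -> D Y -> Ext_eq0 i X Y
    & forall M : lmodType R, exists (K X : lmodType R)
        (f : {linear K -> X}) (g : {linear X -> M}),
        [/\ short_exact f g, C X & wedge D n.-1 K]].

Definition right_cotorsion_pair (R : pzRingType) (n : nat)
    (C D : lmodType R -> Prop) : Prop :=
  [/\ closed_under_summands D,
      forall i, (1 <= i <= n)%N -> forall X Y : lmodType R,
        C X -> D Y -> Ext_eq0 i X Y
    & forall M : lmodType R, exists (X K : lmodType R)
        (f : {linear M -> X}) (g : {linear X -> K}),
        [/\ short_exact f g, D X & vee C n.-1 K]].

(* An A-B-bimodule is a left A-module V with a commuting right action         *)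
(* [ract v b] of B.                                                           *)
HB.mixin Record Lmodule_isBimodule (A B : pzRingType) V
    of GRing.Lmodule A V := {
  ract : V -> B -> V;
  ractDl : forall b : B, {morph ract^~ b : v w / v + w};
  ractDr : forall v : V, {morph ract v : b c / b + c};
  ract1 : forall v : V, ract v 1 = v;
  ractA : forall (v : V) (b c : B), ract (ract v b) c = ract v (b * c);
  ractZ : forall (a : A) (v : V) (b : B), ract (a *: v) b = a *: ract v b
}.

#[short(type="bimodType")]
HB.structure Definition Bimodule (A B : pzRingType) :=
  {V of GRing.Lmodule A V & Lmodule_isBimodule A B V}.

Section BimoduleTheory.
Variables (A B : pzRingType) (V : bimodType A B).

Lemma ract0l (b : B) : ract (0 : V) b = 0.
Proof. by apply: (addrI (ract 0 b)); rewrite -ractDl !addr0. Qed.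

Lemma ract0r (v : V) : ract v (0 : B) = 0.
Proof. by apply: (addrI (ract v 0)); rewrite -ractDr !addr0. Qed.

End BimoduleTheory.

Lemma linear_ext (R : pzRingType) (M N : lmodType R)
  (f g : {linear M -> N}) : f =1 g -> f = g.
Proof.
move=> /funext; case: f g => [f [[[f1 f2]] [f3]]] [g [[[g1 g2]] [g3]]] /= e.
by subst g; do 2!f_equal; f_equal; apply: Prop_irrelevance.
Qed.

(* Hom_A(V, X), a left B-module through (b phi)(v) = phi (v b).               *)
Definition bhom (A B : pzRingType) (V : bimodType A B) (X : lmodType A) : Type :=
  {linear V -> X}.

Section Hom.
Variables (A B : pzRingType) (V : bimodType A B) (X : lmodType A).

HB.instance Definition _ := gen_eqMixin (bhom V X).
HB.instance Definition _ := gen_choiceMixin (bhom V X).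

Definition bhom_fun (f : bhom V X) : {linear V -> X} := f.

Lemma bhom_ext (f g : bhom V X) : bhom_fun f =1 bhom_fun g -> f = g.
Proof. exact: linear_ext. Qed.

Let zero_fun (v : V) : X := 0.
Let opp_fun (f : bhom V X) (v : V) : X := - bhom_fun f v.
Let add_fun (f g : bhom V X) (v : V) : X := bhom_fun f v + bhom_fun g v.
Let act_fun (b : B) (f : bhom V X) (v : V) : X := bhom_fun f (ract v b).

Fact zero_linear : linear zero_fun.
Proof. by move=> a v w; rewrite /zero_fun scaler0 addr0. Qed.
Fact opp_linear f : linear (opp_fun f).
Proof. by move=> a v w; rewrite /opp_fun linearP opprD scalerN. Qed.
Fact add_linear f g : linear (add_fun f g).
Proof. by move=> a v w; rewrite /add_fun !linearP scalerDr addrACA. Qed.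
Fact act_linear b f : linear (act_fun b f).
Proof. by move=> a v w; rewrite /act_fun ractDl ractZ linearP. Qed.

Definition bhom0 : bhom V X :=
  HB.pack zero_fun (GRing.isLinear.Build A V X *:%R zero_fun zero_linear).
Definition bhomN (f : bhom V X) : bhom V X :=
  HB.pack (opp_fun f)
    (GRing.isLinear.Build A V X *:%R (opp_fun f) (opp_linear f)).
Definition bhomD (f g : bhom V X) : bhom V X :=
  HB.pack (add_fun f g)
    (GRing.isLinear.Build A V X *:%R (add_fun f g) (add_linear f g)).
Definition bhomZ (b : B) (f : bhom V X) : bhom V X :=
  HB.pack (act_fun b f)
    (GRing.isLinear.Build A V X *:%R (act_fun b f) (act_linear b f)).

Fact bhomDA : associative bhomD.
Proof. by move=> f g h; apply: bhom_ext => v; apply: addrA. Qed.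
Fact bhomDC : commutative bhomD.
Proof. by move=> f g; apply: bhom_ext => v; apply: addrC. Qed.
Fact bhom0D : left_id bhom0 bhomD.
Proof. by move=> f; apply: bhom_ext => v; apply: add0r. Qed.
Fact bhomND : left_inverse bhom0 bhomN bhomD.
Proof. by move=> f; apply: bhom_ext => v; apply: addNr. Qed.

HB.instance Definition _ :=
  GRing.isZmodule.Build (bhom V X) bhomDA bhomDC bhom0D bhomND.

Fact bhomZA b c f : bhomZ b (bhomZ c f) = bhomZ (b * c) f.
Proof. by apply: bhom_ext => v; rewrite /= /act_fun /= /act_fun ractA. Qed.
Fact bhom1Z : left_id 1 bhomZ.
Proof. by move=> f; apply: bhom_ext => v; rewrite /= /act_fun ract1. Qed.
Fact bhomZDr : right_distributive bhomZ +%R.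
Proof. by move=> b f g; apply: bhom_ext. Qed.
Fact bhomZDl f : {morph bhomZ^~ f : b c / b + c}.
Proof. by move=> b c; apply: bhom_ext => v; rewrite /= /act_fun ractDr linearD. Qed.

HB.instance Definition _ :=
  GRing.Zmodule_isLmodule.Build B (bhom V X) bhomZA bhom1Z bhomZDr bhomZDl.

End Hom.

(* Hom_A(V, h).                                                               *)
Section HomMap.
Variables (A B : pzRingType) (V : bimodType A B).
Variables (X Y : lmodType A) (h : {linear X -> Y}).

Definition bhom_map_fun (f : bhom V X) : bhom V Y := h \o bhom_fun f.

Fact bhom_map_linear : linear bhom_map_fun.
Proof. by move=> b f g; apply: bhom_ext => v; rewrite /= linearD. Qed.

HB.instance Definition _ := GRing.isLinear.Build B (bhom V X) (bhom V Y) *:%R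
  bhom_map_fun bhom_map_linear.

Definition bhom_map : {linear bhom V X -> bhom V Y} := bhom_map_fun.

End HomMap.

(* V (x)_B Y, a left A-module. An element is a formal sum of pairs (v, y),    *)
(* i.e. a finite list, modulo the congruence generated by commutativity,      *)
(* biadditivity and B-balancedness; -v (x) y is the opposite of v (x) y, so   *)
(* the quotient of the free monoid is already a group.                        *)
Inductive teq (A B : pzRingType) (V : bimodType A B) (Y : lmodType B) :
    seq (V * Y) -> seq (V * Y) -> Prop :=
| teq_refl s : teq s s
| teq_sym s t : teq s t -> teq t s
| teq_trans s t r : teq s t -> teq t r -> teq s r
| teq_cat s s' t t' : teq s s' -> teq t t' -> teq (s ++ t) (s' ++ t')
| teq_comm s t : teq (s ++ t) (t ++ s)
| teq_zero y : teq [:: (0, y)] [::]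
| teq_Dl v w y : teq [:: (v + w, y)] [:: (v, y); (w, y)]
| teq_Dr v y z : teq [:: (v, y + z)] [:: (v, y); (v, z)]
| teq_bal v b y : teq [:: (ract v b, y)] [:: (v, b *: y)].

Section Tensor.
Variables (A B : pzRingType) (V : bimodType A B) (Y : lmodType B).

Definition teqb : rel (seq (V * Y)) := fun s t => `[< teq s t >].

Fact teqb_equiv : equiv_class_of teqb.
Proof.
split=> [s|s t|t s r].
- exact/asboolP/teq_refl.
- by apply/asboolP/asboolP; apply: teq_sym.
- by move=> /asboolP st /asboolP tr; apply/asboolP; apply: teq_trans tr.
Qed.

Canonical teqb_equivRel := EquivRelPack teqb_equiv.

Definition tensor : Type := {eq_quot teqb}.

HB.instance Definition _ := Choice.on tensor.
HB.instance Definition _ := Quotient.on tensor.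

Definition tcls (s : seq (V * Y)) : tensor := \pi_tensor s.

Lemma tclsP s t : tcls s = tcls t <-> teq s t.
Proof.
split=> [/eqmodP /asboolP //|st].
by apply/eqmodP/asboolP.
Qed.

Lemma tcls_repr x : tcls (repr x) = x. Proof. exact: reprK. Qed.

Lemma tensor_ind (P : tensor -> Prop) : (forall s, P (tcls s)) -> forall x, P x.
Proof. by move=> Ps x; rewrite -(tcls_repr x). Qed.

Lemma repr_tcls s : teq (repr (tcls s)) s.
Proof. by apply/tclsP; rewrite tcls_repr. Qed.

Definition pure (v : V) (y : Y) : tensor := tcls [:: (v, y)].

Let tN (s : seq (V * Y)) := [seq (- p.1, p.2) | p <- s].
Let tZ (a : A) (s : seq (V * Y)) := [seq (a *: p.1, p.2) | p <- s].

Fact teq_N s t : teq s t -> teq (tN s) (tN t).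
Proof.
elim=> {s t} [s|s t _|s t r _ + _|s s' t t' _ + _|s t|y|v w y|v y z|v b y].
- exact: teq_refl.
- exact: teq_sym.
- exact: teq_trans.
- by rewrite /tN !map_cat; apply: teq_cat.
- by rewrite /tN !map_cat; apply: teq_comm.
- by rewrite /tN /= oppr0; apply: teq_zero.
- by rewrite /tN /= opprD; apply: teq_Dl.
- exact: teq_Dr.
- have -> : tN [:: (ract v b, y)] = [:: (ract (- v) b, y)].
    rewrite /tN /=; congr [:: (_, _)]; apply: (addrI (ract v b)).
    by rewrite -ractDl !subrr ract0l.
  exact: teq_bal.
Qed.

Fact teq_Z a s t : teq s t -> teq (tZ a s) (tZ a t).
Proof.
elim=> {s t} [s|s t _|s t r _ + _|s s' t t' _ + _|s t|y|v w y|v y z|v b y].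
- exact: teq_refl.
- exact: teq_sym.
- exact: teq_trans.
- by rewrite /tZ !map_cat; apply: teq_cat.
- by rewrite /tZ !map_cat; apply: teq_comm.
- by rewrite /tZ /= scaler0; apply: teq_zero.
- by rewrite /tZ /= scalerDr; apply: teq_Dl.
- exact: teq_Dr.
- by rewrite /tZ /= -ractZ; apply: teq_bal.
Qed.

Definition tensor0 : tensor := tcls [::].
Definition tensorN (x : tensor) : tensor := tcls (tN (repr x)).
Definition tensorD (x y : tensor) : tensor := tcls (repr x ++ repr y).
Definition tensorZ (a : A) (x : tensor) : tensor := tcls (tZ a (repr x)).

Fact tensorNE s : tensorN (tcls s) = tcls (tN s).
Proof. by apply/tclsP; apply: teq_N; apply: repr_tcls. Qed.
Fact tensorDE s t : tensorD (tcls s) (tcls t) = tcls (s ++ t).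
Proof. by apply/tclsP; apply: teq_cat; apply: repr_tcls. Qed.
Fact tensorZE a s : tensorZ a (tcls s) = tcls (tZ a s).
Proof. by apply/tclsP; apply: teq_Z; apply: repr_tcls. Qed.

Fact tensorDA : associative tensorD.
Proof.
by elim/tensor_ind=> s; elim/tensor_ind=> t; elim/tensor_ind=> r;
   rewrite !tensorDE catA.
Qed.
Fact tensorDC : commutative tensorD.
Proof.
elim/tensor_ind=> s; elim/tensor_ind=> t; rewrite !tensorDE.
exact/tclsP/teq_comm.
Qed.
Fact tensor0D : left_id tensor0 tensorD.
Proof. by elim/tensor_ind=> s; rewrite tensorDE. Qed.
Fact tensorND : left_inverse tensor0 tensorN tensorD.
Proof.
elim/tensor_ind=> s; rewrite tensorNE tensorDE; apply/tclsP.
elim: s => [|[v y] s IHs] /=; first exact: teq_refl.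
have: teq (tN s ++ s) [::] by exact: IHs.
rewrite -[(- v, y) :: _]/([:: (- v, y)] ++ (tN s ++ (v, y) :: s)) => IH.
apply: teq_trans (_ : teq _ ([:: (- v, y)] ++ ([:: (v, y)] ++ (tN s ++ s)))) _.
  apply: teq_cat; first exact: teq_refl.
  rewrite -[(v, y) :: s]/([:: (v, y)] ++ s) !catA.
  by apply: teq_cat; [apply: teq_comm | apply: teq_refl].
rewrite catA -[[::]]/([::] ++ [::]); apply: teq_cat IH.
apply: teq_trans (teq_zero V y); rewrite -(addNr v).
exact/teq_sym/teq_Dl.
Qed.

HB.instance Definition _ :=
  GRing.isZmodule.Build tensor tensorDA tensorDC tensor0D tensorND.

Lemma tclsD s t : tcls s + tcls t = tcls (s ++ t).
Proof. exact: tensorDE. Qed.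

Fact tensorZA a b x : tensorZ a (tensorZ b x) = tensorZ (a * b) x.
Proof.
elim/tensor_ind: x => s; rewrite !tensorZE /tZ -map_comp; congr tcls.
by apply: eq_map => p /=; rewrite scalerA.
Qed.
Fact tensor1Z : left_id 1 tensorZ.
Proof.
elim/tensor_ind=> s; rewrite tensorZE; congr tcls.
by rewrite -[RHS]map_id; apply: eq_map => -[v y] /=; rewrite scale1r.
Qed.
Fact tensorZDr : right_distributive tensorZ +%R.
Proof.
move=> a; elim/tensor_ind=> s; elim/tensor_ind=> t.
by rewrite tclsD !tensorZE tclsD /tZ map_cat.
Qed.
Fact tensorZDl x : {morph tensorZ^~ x : a b / a + b}.
Proof.
move=> a b; elim/tensor_ind: x => s; rewrite !tensorZE tclsD; apply/tclsP.
elim: s => [|[v y] s IHs] /=; first exact: teq_refl.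
rewrite -[_ :: tZ _ s]/([:: ((a + b) *: v, y)] ++ tZ (a + b) s).
apply: teq_trans (teq_cat (teq_refl _) IHs) _; rewrite scalerDl.
apply: teq_trans (teq_cat (teq_Dl _ _ _) (teq_refl _)) _.
rewrite -[_ :: tZ a s ++ _]/([:: (a *: v, y)] ++ (tZ a s ++ [:: (b *: v, y)] ++ tZ b s)).
rewrite -[[:: (a *: v, y); _]]/([:: (a *: v, y)] ++ [:: (b *: v, y)]) -catA.
apply: teq_cat; first exact: teq_refl.
by rewrite !catA; apply: teq_cat; [apply: teq_comm | apply: teq_refl].
Qed.

HB.instance Definition _ :=
  GRing.Zmodule_isLmodule.Build A tensor tensorZA tensor1Z tensorZDr tensorZDl.

Lemma pureDl v w y : pure (v + w) y = pure v y + pure w y.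
Proof. by rewrite tclsD; apply/tclsP/teq_Dl. Qed.
Lemma pureDr v y z : pure v (y + z) = pure v y + pure v z.
Proof. by rewrite tclsD; apply/tclsP/teq_Dr. Qed.
Lemma pure_bal v b y : pure (ract v b) y = pure v (b *: y).
Proof. exact/tclsP/teq_bal. Qed.
Lemma pureZ a v y : pure (a *: v) y = a *: pure v y.
Proof. by symmetry; apply: tensorZE. Qed.

Lemma tcls_sum s : tcls s = \sum_(p <- s) pure p.1 p.2.
Proof.
elim: s => [|[v y] s IHs]; first by rewrite big_nil.
by rewrite big_cons -IHs tclsD.
Qed.

End Tensor.

(* The linear map on V (x)_B Y given by v (x) y |-> phi v y.                  *)
Section Lift.
Variables (A B : pzRingType) (V : bimodType A B) (Y : lmodType B).
Variable X : lmodType A.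

Record balanced_map := BalancedMap {
  bal_fun : V -> Y -> X;
  bal_Dl : forall y, {morph bal_fun^~ y : v w / v + w};
  bal_Dr : forall v, {morph bal_fun v : y z / y + z};
  bal_bal : forall v b y, bal_fun (ract v b) y = bal_fun v (b *: y);
  bal_Z : forall a v y, bal_fun (a *: v) y = a *: bal_fun v y
}.

Variable phi : balanced_map.

Definition tlift (x : tensor V Y) : X :=
  \sum_(p <- repr x) bal_fun phi p.1 p.2.

Fact teq_sum s t : teq s t ->
  \sum_(p <- s) bal_fun phi p.1 p.2 = \sum_(p <- t) bal_fun phi p.1 p.2.
Proof.
elim=> {s t}
  [s|s t _|s t r _ + _|s s' t t' _ e _ e'|s t|y|v w y|v y z|v b y] //.
- by move=> -> ->.
- by rewrite !big_cat /= e e'.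
- by rewrite !big_cat /= addrC.
- rewrite big_seq1 big_nil; apply: (addrI (bal_fun phi 0 y)).
  by rewrite -bal_Dl !addr0.
- by rewrite !big_cons !big_nil !addr0 bal_Dl.
- by rewrite !big_cons !big_nil !addr0 bal_Dr.
- by rewrite !big_seq1 bal_bal.
Qed.

Lemma tlift_tcls s : tlift (tcls s) = \sum_(p <- s) bal_fun phi p.1 p.2.
Proof. by apply: teq_sum; apply: repr_tcls. Qed.

Lemma tlift_pure v y : tlift (pure v y) = bal_fun phi v y.
Proof. by rewrite tlift_tcls big_seq1. Qed.

Fact tlift_linear : linear tlift.
Proof.
move=> a; elim/tensor_ind=> s; elim/tensor_ind=> t.
have -> : a *: tcls s = tcls [seq (a *: p.1, p.2) | p <- s] by apply: tensorZE.
rewrite tclsD !tlift_tcls big_cat big_map scaler_sumr; congr (_ + _).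
by apply: eq_bigr => p _; rewrite bal_Z.
Qed.

HB.instance Definition _ :=
  GRing.isLinear.Build A (tensor V Y) X *:%R tlift tlift_linear.

End Lift.

(* V (x)_B h.                                                                 *)
Section TensorMap.
Variables (A B : pzRingType) (V : bimodType A B).
Variables (Y Z : lmodType B) (h : {linear Y -> Z}).

Let phi (v : V) (y : Y) := pure v (h y).

Fact tmap_Dl y : {morph phi^~ y : v w / v + w}.
Proof. by move=> v w; apply: pureDl. Qed.
Fact tmap_Dr v : {morph phi v : y z / y + z}.
Proof. by move=> y z; rewrite /phi linearD pureDr. Qed.
Fact tmap_bal v b y : phi (ract v b) y = phi v (b *: y).
Proof. by rewrite /phi linearZ pure_bal. Qed.
Fact tmap_Z a v y : phi (a *: v) y = a *: phi v y.
Proof. exact: pureZ. Qed.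

Definition tmap_balanced : balanced_map V Y (tensor V Z) :=
  BalancedMap tmap_Dl tmap_Dr tmap_bal tmap_Z.

Definition tensor_map : {linear tensor V Y -> tensor V Z} :=
  tlift tmap_balanced.

End TensorMap.

(* Tor_i^B(V, Y) = 0, computed from any projective resolution of Y.           *)
Definition Tor_eq0 (A B : pzRingType) (i : nat) (V : bimodType A B)
    (Y : lmodType B) : Prop :=
  forall (P : nat -> lmodType B) (d : forall j, {linear P j.+1 -> P j})
         (e : {linear P 0 -> Y}),
    (forall j, projective (P j)) -> left_resolution d e ->
    match i with
    | 0 => forall x : tensor V (P 0),
        exists y : tensor V (P 1), tensor_map V (d 0) y = x
    | j.+1 => exact (tensor_map V (d j.+1)) (tensor_map V (d j))
    end.

(* The Morita ring Lambda_(0,0); the matrix with rows (a, v) and (u, b) is    *)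
(* stored as ((a, v), (u, b)).                                                *)
Definition morita0 (A B : pzRingType) (V : bimodType A B) (U : bimodType B A) :
  Type := ((A * V) * (U * B))%type.

Section Morita.
Variables (A B : pzRingType) (V : bimodType A B) (U : bimodType B A).
Local Notation L := (morita0 V U).

HB.instance Definition _ := GRing.Zmodule.on L.

Definition mor_mx (a : A) (v : V) (u : U) (b : B) : L := ((a, v), (u, b)).

Definition mor_one : L := mor_mx 1 0 0 1.
Definition mor_mul (x y : L) : L :=
  let: ((a1, v1), (u1, b1)) := x in
  let: ((a2, v2), (u2, b2)) := y in
  mor_mx (a1 * a2) (a1 *: v2 + ract v1 b2) (ract u1 a2 + b1 *: u2) (b1 * b2).

Lemma mor_mxD a1 v1 u1 b1 a2 v2 u2 b2 :
  mor_mx a1 v1 u1 b1 + mor_mx a2 v2 u2 b2 =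
  mor_mx (a1 + a2) (v1 + v2) (u1 + u2) (b1 + b2).
Proof. by []. Qed.

Fact mor_mulA : associative mor_mul.
Proof.
move=> [[a1 v1] [u1 b1]] [[a2 v2] [u2 b2]] [[a3 v3] [u3 b3]] /=.
rewrite /mor_mx !mulrA !scalerDr !ractDl !scalerA !ractA !ractZ.
by rewrite !addrA.
Qed.
Fact mor_mul1l : left_id mor_one mor_mul.
Proof.
move=> [[a v] [u b]] /=.
by rewrite /mor_mx !mul1r !scale1r !ract0l addr0 add0r.
Qed.
Fact mor_mul1r : right_id mor_one mor_mul.
Proof.
move=> [[a v] [u b]] /=.
by rewrite /mor_mx !mulr1 !scaler0 !ract1 addr0 add0r.
Qed.
Fact mor_mulDl : left_distributive mor_mul +%R.
Proof.
move=> [[a1 v1] [u1 b1]] [[a2 v2] [u2 b2]] [[a3 v3] [u3 b3]] /=.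
rewrite mor_mxD /mor_mx !mulrDl !scalerDl !ractDl.
by congr ((_, _), (_, _)); rewrite addrACA.
Qed.
Fact mor_mulDr : right_distributive mor_mul +%R.
Proof.
move=> [[a1 v1] [u1 b1]] [[a2 v2] [u2 b2]] [[a3 v3] [u3 b3]] /=.
rewrite mor_mxD /mor_mx !mulrDr !scalerDr !ractDr.
by congr ((_, _), (_, _)); rewrite addrACA.
Qed.

HB.instance Definition _ := GRing.Zmodule_isPzRing.Build L
  mor_mulA mor_mul1l mor_mul1r mor_mulDl mor_mulDr.

Lemma mor_mxM a1 v1 u1 b1 a2 v2 u2 b2 :
  mor_mx a1 v1 u1 b1 * mor_mx a2 v2 u2 b2 =
  mor_mx (a1 * a2) (a1 *: v2 + ract v1 b2) (ract u1 a2 + b1 *: u2) (b1 * b2).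
Proof. by []. Qed.

Lemma mor_mx1 : 1 = mor_mx 1 0 0 1. Proof. by []. Qed.

Definition in11 (a : A) : L := mor_mx a 0 0 0.
Definition in12 (v : V) : L := mor_mx 0 v 0 0.
Definition in21 (u : U) : L := mor_mx 0 0 u 0.
Definition in22 (b : B) : L := mor_mx 0 0 0 b.

Lemma in11D a a' : in11 (a + a') = in11 a + in11 a'.
Proof. by rewrite mor_mxD !addr0. Qed.
Lemma in12D v v' : in12 (v + v') = in12 v + in12 v'.
Proof. by rewrite mor_mxD !addr0. Qed.
Lemma in21D u u' : in21 (u + u') = in21 u + in21 u'.
Proof. by rewrite mor_mxD !addr0. Qed.
Lemma in22D b b' : in22 (b + b') = in22 b + in22 b'.
Proof. by rewrite mor_mxD !addr0. Qed.

Let simpE := (mor_mxM, mul0r, mulr0, scaler0, scale0r, ract0l, ract0r,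
              addr0, add0r).

Lemma in11M a a' : in11 a * in11 a' = in11 (a * a').
Proof. by rewrite /in11 !simpE. Qed.
Lemma in22M b b' : in22 b * in22 b' = in22 (b * b').
Proof. by rewrite /in22 !simpE. Qed.
Lemma in1112 a v : in11 a * in12 v = in12 (a *: v).
Proof. by rewrite /in11 /in12 !simpE. Qed.
Lemma in1222 v b : in12 v * in22 b = in12 (ract v b).
Proof. by rewrite /in12 /in22 !simpE. Qed.
Lemma in2221 b u : in22 b * in21 u = in21 (b *: u).
Proof. by rewrite /in21 /in22 !simpE. Qed.
Lemma in2111 u a : in21 u * in11 a = in21 (ract u a).
Proof. by rewrite /in21 /in11 !simpE. Qed.

End Morita.

(* The tuple (X, Y, f, g) of a left Lambda_(0,0)-module M: X = e11 M and      *)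
(* Y = e22 M for the diagonal idempotents e11 and e22, and f and g are        *)
(* multiplication by the off-diagonal entries.                                *)
Definition mod_top (A B : pzRingType) (V : bimodType A B) (U : bimodType B A)
    (M : lmodType (morita0 V U)) : Type :=
  {x : M | in11 V U 1 *: x == x}.

Definition mod_bot (A B : pzRingType) (V : bimodType A B) (U : bimodType B A)
    (M : lmodType (morita0 V U)) : Type :=
  {y : M | in22 V U 1 *: y == y}.

Section Components.
Variables (A B : pzRingType) (V : bimodType A B) (U : bimodType B A).
Variable M : lmodType (morita0 V U).
Local Notation X := (mod_top M).
Local Notation Y := (mod_bot M).
Local Notation in11 := (in11 V U).
Local Notation in12 := (@in12 _ _ V U).
Local Notation in21 := (@in21 _ _ V U).
Local Notation in22 := (in22 V U).

HB.instance Definition _ := Choice.on X.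
HB.instance Definition _ := SubChoice.on X.
HB.instance Definition _ := Choice.on Y.
HB.instance Definition _ := SubChoice.on Y.

Fact top_closed : zmod_closed [pred x : M | in11 1 *: x == x].
Proof.
split=> [|x y]; rewrite !inE ?scaler0 // => /eqP ex /eqP ey.
by rewrite scalerBr ex ey.
Qed.
Fact bot_closed : zmod_closed [pred y : M | in22 1 *: y == y].
Proof.
split=> [|x y]; rewrite !inE ?scaler0 // => /eqP ex /eqP ey.
by rewrite scalerBr ex ey.
Qed.

HB.instance Definition _ := GRing.SubChoice_isSubZmodule.Build M _ X top_closed.
HB.instance Definition _ := GRing.SubChoice_isSubZmodule.Build M _ Y bot_closed.

Lemma topP (x : X) : in11 1 *: val x = val x. Proof. exact/eqP/(valP x). Qed.
Lemma botP (y : Y) : in22 1 *: val y = val y. Proof. exact/eqP/(valP y). Qed.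

Fact top_11 (a : A) (m : M) : in11 1 *: (in11 a *: m) == in11 a *: m.
Proof. by rewrite scalerA in11M mul1r. Qed.
Fact top_12 (v : V) (m : M) : in11 1 *: (in12 v *: m) == in12 v *: m.
Proof. by rewrite scalerA in1112 scale1r. Qed.
Fact bot_22 (b : B) (m : M) : in22 1 *: (in22 b *: m) == in22 b *: m.
Proof. by rewrite scalerA in22M mul1r. Qed.
Fact bot_21 (u : U) (m : M) : in22 1 *: (in21 u *: m) == in21 u *: m.
Proof. by rewrite scalerA in2221 scale1r. Qed.

Let mk_top (m : M) (e : in11 1 *: m == m) : X := exist _ m e.
Let mk_bot (m : M) (e : in22 1 *: m == m) : Y := exist _ m e.

Definition top_act (a : A) (x : X) : X := mk_top (top_11 a (val x)).
Definition bot_act (b : B) (y : Y) : Y := mk_bot (bot_22 b (val y)).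

Fact top_actA a b x : top_act a (top_act b x) = top_act (a * b) x.
Proof. by apply: val_inj; rewrite /= scalerA in11M. Qed.
Fact top_act1 : left_id 1 top_act.
Proof. by move=> x; apply: val_inj; rewrite /= topP. Qed.
Fact top_actDr : right_distributive top_act +%R.
Proof. by move=> a x y; apply: val_inj; rewrite /= scalerDr. Qed.
Fact top_actDl x : {morph top_act^~ x : a b / a + b}.
Proof. by move=> a b; apply: val_inj; rewrite /= in11D scalerDl. Qed.
HB.instance Definition _ := GRing.Zmodule_isLmodule.Build A X
  top_actA top_act1 top_actDr top_actDl.

Fact bot_actA a b y : bot_act a (bot_act b y) = bot_act (a * b) y.
Proof. by apply: val_inj; rewrite /= scalerA in22M. Qed.
Fact bot_act1 : left_id 1 bot_act.
Proof. by move=> y; apply: val_inj; rewrite /= botP. Qed.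
Fact bot_actDr : right_distributive bot_act +%R.
Proof. by move=> a x y; apply: val_inj; rewrite /= scalerDr. Qed.
Fact bot_actDl y : {morph bot_act^~ y : a b / a + b}.
Proof. by move=> a b; apply: val_inj; rewrite /= in22D scalerDl. Qed.
HB.instance Definition _ := GRing.Zmodule_isLmodule.Build B Y
  bot_actA bot_act1 bot_actDr bot_actDl.

Definition mul_u (u : U) (x : X) : Y := mk_bot (bot_21 u (val x)).
Definition mul_v (v : V) (y : Y) : X := mk_top (top_12 v (val y)).

Fact mul_uDl x : {morph mul_u^~ x : u w / u + w}.
Proof. by move=> u w; apply: val_inj; rewrite /= in21D scalerDl. Qed.
Fact mul_uDr u : {morph mul_u u : x y / x + y}.
Proof. by move=> x y; apply: val_inj; rewrite /= scalerDr. Qed.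
Fact mul_u_bal u a x : mul_u (ract u a) x = mul_u u (a *: x).
Proof. by apply: val_inj; rewrite /= scalerA in2111. Qed.
Fact mul_uZ b u x : mul_u (b *: u) x = b *: mul_u u x.
Proof. by apply: val_inj; rewrite /= scalerA in2221. Qed.

Fact mul_vDl y : {morph mul_v^~ y : v w / v + w}.
Proof. by move=> v w; apply: val_inj; rewrite /= in12D scalerDl. Qed.
Fact mul_vDr v : {morph mul_v v : y z / y + z}.
Proof. by move=> y z; apply: val_inj; rewrite /= scalerDr. Qed.
Fact mul_v_bal v b y : mul_v (ract v b) y = mul_v v (b *: y).
Proof. by apply: val_inj; rewrite /= scalerA in1222. Qed.
Fact mul_vZ a v y : mul_v (a *: v) y = a *: mul_v v y.
Proof. by apply: val_inj; rewrite /= scalerA in1112. Qed.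

(* f : U (x)_A X -> Y and g : V (x)_B Y -> X.                                 *)
Definition str_f : {linear tensor U X -> Y} :=
  tlift (BalancedMap mul_uDl mul_uDr mul_u_bal mul_uZ).
Definition str_g : {linear tensor V Y -> X} :=
  tlift (BalancedMap mul_vDl mul_vDr mul_v_bal mul_vZ).

(* Their adjoints X -> Hom_B(U, Y) and Y -> Hom_A(V, X).                      *)
Fact adj_f_subproof (x : X) : linear (mul_u^~ x).
Proof. by move=> b u w; rewrite mul_uDl mul_uZ. Qed.
Fact adj_g_subproof (y : Y) : linear (mul_v^~ y).
Proof. by move=> a v w; rewrite mul_vDl mul_vZ. Qed.

Definition adj_f_fun (x : X) : bhom U Y := HB.pack (mul_u^~ x)
  (GRing.isLinear.Build B U Y *:%R (mul_u^~ x) (adj_f_subproof x)).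
Definition adj_g_fun (y : Y) : bhom V X := HB.pack (mul_v^~ y)
  (GRing.isLinear.Build A V X *:%R (mul_v^~ y) (adj_g_subproof y)).

Fact adj_f_linear : linear adj_f_fun.
Proof.
by move=> a x y; apply: bhom_ext => u; rewrite /= mul_uDr -mul_u_bal.
Qed.
Fact adj_g_linear : linear adj_g_fun.
Proof.
by move=> b x y; apply: bhom_ext => v; rewrite /= mul_vDr -mul_v_bal.
Qed.

HB.instance Definition _ :=
  GRing.isLinear.Build A X (bhom U Y) *:%R adj_f_fun adj_f_linear.
HB.instance Definition _ :=
  GRing.isLinear.Build B Y (bhom V X) *:%R adj_g_fun adj_g_linear.

Definition adj_f : {linear X -> bhom U Y} := adj_f_fun.
Definition adj_g : {linear Y -> bhom V X} := adj_g_fun.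

End Components.

Section Classes.
Variables (A B : pzRingType) (V : bimodType A B) (U : bimodType B A).
Variables (C : lmodType A -> Prop) (D : lmodType B -> Prop).

Definition class_U (M : lmodType (morita0 V U)) : Prop :=
  C (mod_top M) /\ D (mod_bot M).

Definition class_B (M : lmodType (morita0 V U)) : Prop :=
  [/\ cokernel_in (str_f M) D,
      cokernel_in (str_g M) C,
      exact (tensor_map V (str_f M)) (str_g M)
    & exact (tensor_map U (str_g M)) (str_f M)].

Definition class_J (M : lmodType (morita0 V U)) : Prop :=
  [/\ kernel_in (adj_f M) C,
      kernel_in (adj_g M) D,
      exact (adj_f M) (bhom_map U (adj_g M))
    & exact (adj_g M) (bhom_map V (adj_f M))].

End Classes.

Arguments class_U {A B} V U C D M.
Arguments class_B {A B} V U C D M.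
Arguments class_J {A B} V U C D M.

(* Main.v *)
Require Import Defs.
From HB Require Import structures.
From mathcomp Require Import all_boot all_algebra.
From mathcomp Require Import boolp functions.

Set Implicit Arguments.
Unset Strict Implicit.
Unset Printing Implicit Defensive.

Import GRing.Theory.

Local Open Scope ring_scope.

(** A module over the Morita ring is a tuple [(X, Y, f, g)], and both parts say
that a cotorsion pair of such tuples restricts to the corner [X] and, by
symmetry, to the corner [Y].  Three things have to be transferred.

Summands and approximations.  An [A]-module [M] is the top of the tuple
[(M, 0)], and taking tops is exact.  So a direct summand of [M] is one of
[(M, 0)], and an approximation [0 -> K -> X -> (M, 0) -> 0] has an exact top.

Lengths.  In part (1) the top of [K] must have a short resolution by [C2]; what
is known is a short resolution of [K] by tuples of the class J.  The conditions
defining J say that [X] is an extension of [Hom (U, Ker g)] by [Ker f].  If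
[0 -> L -> J -> N -> 0] is exact and [L] and [J] satisfy them, then so does [N],
and [0 -> Ker f_L -> Ker f_J -> Ker f_N -> 0] is exact ([kernels_ses],
[vf_exact]): the only obstructions are in [Ext^1 (U, Ker g_L)] and
[Ext^1 (V, Ker f_L)], and they vanish because a resolution of length less than
[n] uses up less than [n] degrees of the vanishing of [Ext (U, D2)] and
[Ext (V, C2)].  Induction on the length ([resolved_view_J])
resolves [Ker f_K] by [C2] and [Ker g_K] by [D2]; then [Hom (U, Ker g_K)] is
resolved by [C2] as well ([resolved_bhom]), and closure under extensions puts
the top of [K] in [C2]-wedge ([view_J_top]).  Part (2) is the same with
cokernels, tensor products and Tor ([cokernels_ses], [vG_exact],
[coresolved_view_B], [view_B_top]).

Orthogonality.  In part (1), [N] in [C2] gives the tuple [(N, Hom (V, N))] of J,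
which is coinduced from [N]: homomorphisms into it are [A]-linear maps from the
top to [N].  The top of a free tuple is a direct sum of copies of [A (+) V],
hence acyclic for [Ext (-, N)] up to degree [n], so that the two Ext groups agree
by induction on syzygies ([coinduction_ext]).  In part (2), [X] in [C1] gives the
induced tuple [(X, U (x) X)] of B; the vanishing of [Tor (U, X)] makes induction
turn projective presentations of [X] and of its syzygies into projective
presentations of tuples ([induction_ext]).

Ext and Tor enter only through dimension shifting, which is the same for both:
it is carried out for a class of monomorphisms with a few closure properties
([mono_class], [vanish]). *)

(** * Submodules, kernels and pullbacks *)

Section Submodules.
Variable R : pzRingType.

Record submodule (M : lmodType R) := Submodule {
  submod_pred :> pred M;
  submod_subproof : subsemimod_closed submod_pred
}.

Variables (M : lmodType R) (S : submodule M).

Definition submod_sort : Type := {x : M | submod_pred S x}.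

HB.instance Definition _ := SubChoice.on submod_sort.
HB.instance Definition _ := GRing.SubChoice_isSubLmodule.Build R M _
  submod_sort (submod_subproof S).

End Submodules.

Definition surjective (S T : Type) (f : S -> T) : Prop :=
  forall y, exists x, f x = y.

Definition trivial (R : pzRingType) (M : lmodType R) : Prop :=
  forall x : M, x = 0.

Section LinearMaps.
Variable R : pzRingType.
Implicit Types K L M N P Q T Z : lmodType R.

Definition lin M N (f : M -> N) (fL : linear f) : {linear M -> N} :=
  HB.pack f (GRing.isLinear.Build R M N *:%R f fL).

Definition lid M : {linear M -> M} := idfun.
Definition lcomp M N P (g : {linear N -> P}) (f : {linear M -> N}) :
  {linear M -> P} := g \o f.
Definition lzero M N : {linear M -> N} := \0.
Definition lsub M N (f g : {linear M -> N}) : {linear M -> N} := f \- g.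

Lemma linear_inj M N (f : {linear M -> N}) :
  (forall x, f x = 0 -> x = 0) -> injective f.
Proof.
move=> f0 x y e; apply/eqP; rewrite -subr_eq0; apply/eqP/f0.
by rewrite linearB e subrr.
Qed.

Lemma inj0 M N (f : {linear M -> N}) x : injective f -> f x = 0 -> x = 0.
Proof. by move=> fI; rewrite -(linear0 f) => /fI. Qed.

Fact linl_subproof M N : linear (fun x : M => (x, 0) : M * N).
Proof.
move=> a x y; rewrite -[RHS]/(a *: x + y, a *: 0 + 0).
by rewrite scaler0 addr0.
Qed.
Definition linl M N : {linear M -> (M * N)%type} := lin (@linl_subproof M N).

Fact linr_subproof M N : linear (fun y : N => (0, y) : M * N).
Proof.
move=> a x y; rewrite -[RHS]/(a *: 0 + 0, a *: x + y).
by rewrite scaler0 addr0.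
Qed.
Definition linr M N : {linear N -> (M * N)%type} := lin (@linr_subproof M N).

Fact lcopair_subproof M N P (f : {linear M -> P}) (g : {linear N -> P}) :
  linear (fun p : M * N => f p.1 + g p.2).
Proof. by move=> a [? ?] [? ?] /=; rewrite !linearP /= scalerDr addrACA. Qed.
Definition lcopair M N P (f : {linear M -> P}) (g : {linear N -> P}) :
  {linear (M * N)%type -> P} := lin (lcopair_subproof f g).

Lemma kernel_ex M N (g : {linear M -> N}) :
  exists (K : lmodType R) (k : {linear K -> M}), injective k /\ exact k g.
Proof.
have cl : subsemimod_closed [pred x | g x == 0].
  split; first split; first by rewrite inE linear0.
    by move=> x y; rewrite !inE linearD => /eqP -> /eqP ->; rewrite addr0.
  by move=> a x; rewrite !inE linearZ /= => /eqP ->; rewrite scaler0.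
exists (submod_sort (Submodule cl)), val; split; first exact: val_inj.
move=> y; split=> [e|[x <-]]; last by apply/eqP; apply: (valP x).
have py : submod_pred (Submodule cl) y by rewrite /= e eqxx.
by exists (exist (submod_pred (Submodule cl)) y py).
Qed.

Lemma descend_epi M N P (g : {linear M -> N}) (h : {linear M -> P}) :
  surjective g -> (forall x, g x = 0 -> h x = 0) ->
  exists k : {linear N -> P}, forall x, k (g x) = h x.
Proof.
move=> /choice [s gs] gh.
have hs x y : g x = g y -> h x = h y.
  move=> e; apply/eqP; rewrite -subr_eq0 -linearB; apply/eqP/gh.
  by rewrite linearB e subrr.
have kL : linear (h \o s).
  by move=> a x y /=; rewrite -linearP; apply: hs; rewrite linearP !gs.
by exists (lin kL) => x /=; apply: hs.
Qed.

Lemma lift_mono L M N (j : {linear M -> N}) (h : {linear L -> N}) :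
  injective j -> (forall x, exists y, j y = h x) ->
  exists k : {linear L -> M}, forall x, j (k x) = h x.
Proof.
move=> jI /choice [s js].
have sL : linear s by move=> a x y; apply: jI; rewrite linearP !js linearP.
by exists (lin sL).
Qed.

Lemma bijective_lin M N (f : {linear M -> N}) :
  injective f -> surjective f ->
  exists g : {linear N -> M}, cancel f g /\ cancel g f.
Proof.
move=> fI fS; have [g gK] := lift_mono (h := lid N) fI fS.
by exists g; split=> // x; apply: fI; rewrite gK.
Qed.

Lemma inj_surj_bij M N (f : {linear M -> N}) :
  injective f -> surjective f -> bijective f.
Proof. by move=> fI fS; have [g [? ?]] := bijective_lin fI fS; exists g. Qed.

Lemma bij_surj (S T : Type) (f : S -> T) : bijective f -> surjective f.
Proof. by case=> g _ gK y; exists (g y). Qed.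

Lemma exact0 K M N (f : {linear K -> M}) (g : {linear M -> N}) x :
  exact f g -> g (f x) = 0.
Proof. by move=> fg; apply/fg; exists x. Qed.

Lemma pullback_ex L M N (g : {linear L -> N}) (h : {linear M -> N}) :
  exists (Z : lmodType R) (z1 : {linear Z -> L}) (z2 : {linear Z -> M}),
    [/\ forall z, g (z1 z) = h (z2 z),
        forall x y, g x = h y -> exists z, z1 z = x /\ z2 z = y
      & forall z, z1 z = 0 -> z2 z = 0 -> z = 0].
Proof.
have [Z [k [kI kE]]] := kernel_ex (lsub (lcomp g fst) (lcomp h snd)).
exists Z, (lcomp fst k), (lcomp snd k); split=> [z|x y e|z] /=.
- by apply/eqP; rewrite -subr_eq0; apply/eqP; apply: (exact0 z kE).
- have [|z kz] := (kE (x, y)).1; first by rewrite /= e subrr.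
  by exists z; rewrite kz.
- by move=> e1 e2; apply: (inj0 kI); case: (k z) e1 e2 => ? ? /= -> ->.
Qed.

Lemma joint_lift T L M Z (z1 : {linear Z -> L}) (z2 : {linear Z -> M})
    (a : {linear T -> L}) (b : {linear T -> M}) :
  (forall z, z1 z = 0 -> z2 z = 0 -> z = 0) ->
  (forall t, exists z, z1 z = a t /\ z2 z = b t) ->
  exists w : {linear T -> Z}, forall t, z1 (w t) = a t /\ z2 (w t) = b t.
Proof.
move=> zI /choice [w wE].
have jI z z' : z1 z = z1 z' -> z2 z = z2 z' -> z = z'.
  move=> e1 e2; apply/eqP; rewrite -subr_eq0; apply/eqP.
  by apply: zI; rewrite linearB ?e1 ?e2 subrr.
have wL : linear w.
  move=> c x y; have [e1 e2] := wE (c *: x + y).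
  have [[x1 x2] [y1 y2]] := (wE x, wE y).
  by apply: jI; rewrite ?e1 ?e2 !linearP ?x1 ?x2 ?y1 ?y2.
by exists (lin wL).
Qed.

(** All dimension shifting goes through this base change, which replaces an
extension of [N] by an extension of [Q] with the same kernel. *)
Lemma pullback_ses K L N Q (f : {linear K -> L}) (g : {linear L -> N})
    (h : {linear Q -> N}) : short_exact f g ->
  exists (Z : lmodType R) (z1 : {linear Z -> L}) (z2 : {linear Z -> Q})
    (k : {linear K -> Z}),
    [/\ short_exact k z2, forall x, z1 (k x) = f x,
        forall z, g (z1 z) = h (z2 z),
        forall x y, g x = h y -> exists z, z1 z = x /\ z2 z = y
      & forall z, z1 z = 0 -> z2 z = 0 -> z = 0].
Proof.
move=> [fI fE gS]; have [Z [z1 [z2 [zc zE zI]]]] := pullback_ex g h.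
have [|k kE] := joint_lift (a := f) (b := lzero K Q) zI.
  by move=> x; apply: zE; rewrite (exact0 x fE) linear0.
exists Z, z1, z2, k; split=> //; last by move=> x; case: (kE x).
split=> [|z|y].
- apply: linear_inj => x e; apply: (inj0 fI).
  by have [<- _] := kE x; rewrite e linear0.
- split=> [z0|[x <-]]; last by case: (kE x).
  have [|x fx] := (fE (z1 z)).1; first by rewrite zc z0 linear0.
  exists x; apply/eqP; rewrite -subr_eq0; apply/eqP; have [k1 k2] := kE x.
  by apply: zI; rewrite linearB ?k1 ?k2 ?fx ?z0 ?subrr.
- by have [x gx] := gS (h y); have [z [_ zy]] := zE _ _ gx; exists z.
Qed.

Lemma trivial_ex : exists Z : lmodType R, trivial Z.
Proof.
have [Z [k [kI kE]]] := kernel_ex (lid R^o).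
by exists Z => x; apply: (inj0 kI); apply: (exact0 x kE).
Qed.

End LinearMaps.

(** * Projective modules *)

Section Projectives.
Variable R : pzRingType.
Implicit Types K L M N P Q T Z : lmodType R.

Lemma projective_retract P Q (s : {linear P -> Q}) (r : {linear Q -> P}) :
  (forall x, r (s x) = x) -> projective Q -> projective P.
Proof.
move=> rs Qp M N g h gS; have [k kE] := Qp M N g (lcomp h r) gS.
by exists (lcomp k s) => x /=; rewrite kE /= rs.
Qed.

Lemma projective_prod P Q : projective P -> projective Q ->
  projective (P * Q)%type.
Proof.
move=> Pp Qp M N g h gS.
have [k1 E1] := Pp M N g (lcomp h (linl P Q)) gS.
have [k2 E2] := Qp M N g (lcomp h (linr P Q)) gS.
exists (lcopair k1 k2) => -[x y] /=; rewrite linearD E1 E2 /= -linearD.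
by congr (h (_, _)); rewrite /= ?addr0 ?add0r.
Qed.

Lemma projective_regular : projective R^o.
Proof.
move=> M N g h gS; have [m gm] := gS (h 1).
have kL : linear (fun a : R^o => (a : R) *: m).
  by move=> a x y; rewrite scalerDl scalerA.
exists (lin kL) => x /=; rewrite linearZ /= gm -linearZ.
by congr (h _); apply: mulr1.
Qed.

Lemma projective_retraction K L P (f : {linear K -> L}) (g : {linear L -> P}) :
  short_exact f g -> projective P ->
  exists r : {linear L -> K}, forall x, r (f x) = x.
Proof.
move=> [fI fE gS] Pp; have [s gs] := Pp _ _ g (lid P) gS.
have [|r rE] := lift_mono (h := lsub (lid L) (lcomp s g)) fI.
  by move=> y; apply/fE; rewrite linearB /= gs subrr.
exists r => x; apply: fI; rewrite rE /= (exact0 x fE).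
by rewrite linear0 subr0.
Qed.

End Projectives.

(** * Finitely supported functions *)

Section FiniteSupport.
Variables (R : pzRingType) (S : choiceType).
Implicit Types W N : lmodType R.

Fact finsupp_closed W : subsemimod_closed
  [pred d : S -> W | `[< exists r : seq S, forall s, d s != 0 -> s \in r >]].
Proof.
split; first split.
- by apply/asboolP; exists [::] => s; rewrite eqxx.
- move=> d d' /asboolP [r rP] /asboolP [r' rP']; apply/asboolP.
  exists (r ++ r') => s; rewrite mem_cat; apply: contraR.
  rewrite negb_or => /andP [sr sr'].
  have /eqP e : d s == 0 by apply: contraR sr => /rP.
  have /eqP e' : d' s == 0 by apply: contraR sr' => /rP'.
  by rewrite -[(d + d') s]/(d s + d' s) e e' addr0.
- move=> a d /asboolP [r rP]; apply/asboolP; exists r => s nz; apply: rP.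
  by apply: contraNneq nz => e; rewrite -[(a *: d) s]/(a *: d s) e scaler0.
Qed.

Definition finsupp W : submodule (S -> W) := Submodule (finsupp_closed W).
(** The direct sum of copies of [W] indexed by [S]; as its elements are
functions, injectivity and exactness can be checked at each coordinate. *)
Definition dsum W : lmodType R := submod_sort (finsupp W).

Definition dcoord W (d : dsum W) : S -> W := val d.

Definition covers W (r : seq S) (d : S -> W) :=
  uniq r /\ forall s, d s != 0 -> s \in r.

Lemma covers_ex W (d : dsum W) : exists r, covers r (dcoord d).
Proof.
have /asboolP [r rP] := valP d; exists (undup r); split=> [|s /rP].
  exact: undup_uniq.
by rewrite mem_undup.
Qed.

Lemma covers_sub W (r r' : seq S) (d : S -> W) :
  uniq r' -> {subset r <= r'} -> covers r d -> covers r' d.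
Proof. by move=> u rr' [_ rP]; split=> // s /rP /rr'. Qed.

Lemma dsum_ext W (d d' : dsum W) : dcoord d =1 dcoord d' -> d = d'.
Proof. by move=> /funext /val_inj. Qed.

Lemma dcoordP W a (d d' : dsum W) s :
  dcoord (a *: d + d') s = a *: dcoord d s + dcoord d' s.
Proof. by []. Qed.

Lemma dcoord_sum W (I : Type) (r : seq I) (F : I -> dsum W) s :
  dcoord (\sum_(i <- r) F i) s = \sum_(i <- r) dcoord (F i) s.
Proof. by elim/big_rec2: _ => // i x y _ <-. Qed.

Lemma dsum_mk W (d : S -> W) (r : seq S) : (forall s, d s != 0 -> s \in r) ->
  exists d' : dsum W, dcoord d' = d.
Proof.
move=> rP; have fin : submod_pred (finsupp W) d by apply/asboolP; exists r.
by exists (exist (submod_pred (finsupp W)) d fin).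
Qed.

Lemma dinj_ex W : exists i : S -> {linear W -> dsum W},
  forall s w t, dcoord (i s w) t = if t == s then w else 0.
Proof.
have /choice [i iE] : forall s, exists i : {linear W -> dsum W},
    forall w t, dcoord (i w) t = if t == s then w else 0.
  move=> s; have /choice [i iE] : forall w : W, exists d : dsum W,
      dcoord d = fun t => if t == s then w else 0.
    move=> w; apply: (@dsum_mk _ _ [:: s]) => t.
    by rewrite inE; case: (t =P s) => // _; rewrite eqxx.
  have iL : linear i.
    move=> a x y; apply: dsum_ext => t; rewrite dcoordP !iE.
    by case: eqP; rewrite // scaler0 addr0.
  by exists (lin iL) => w t; rewrite /= iE.
by exists i.
Qed.

Lemma covers_sum W N (F : S -> {linear W -> N}) (d : S -> W) r r' :
  covers r d -> covers r' d ->
  \sum_(s <- r) F s (d s) = \sum_(s <- r') F s (d s).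
Proof.
have nz t : \sum_(s <- t) F s (d s) = \sum_(s <- [seq s <- t | d s != 0]) F s (d s).
  rewrite big_filter [RHS]big_mkcond; apply: eq_bigr => s _.
  by case: eqP => //= ->; rewrite linear0.
move=> [u rP] [u' rP']; rewrite nz [RHS]nz; apply: perm_big.
apply: uniq_perm; rewrite ?filter_uniq // => s; rewrite !mem_filter.
by case: eqP => //= /eqP ds; rewrite rP // rP'.
Qed.

(** The universal property of the direct sum.  The sum may run over any list
that covers the support, so that several elements can share one list. *)
Lemma dsum_lift W N (F : S -> {linear W -> N}) :
  exists h : {linear dsum W -> N},
    forall d r, covers r (dcoord d) -> h d = \sum_(s <- r) F s (dcoord d s).
Proof.
have /choice [supp suppP] := @covers_ex W.
pose h d := \sum_(s <- supp d) F s (dcoord d s).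
have hE d r : covers r (dcoord d) -> h d = \sum_(s <- r) F s (dcoord d s).
  by move=> rP; apply: covers_sum.
have hL : linear h.
  move=> a d d'.
  set r := undup (supp (a *: d + d') ++ supp d ++ supp d').
  have cr e : e \in [:: a *: d + d'; d; d'] -> covers r (dcoord e).
    move=> ein; apply: (covers_sub _ _ (suppP e)); first exact: undup_uniq.
    move=> s se; rewrite mem_undup !mem_cat; move: ein se.
    by rewrite !inE => /or3P [] /eqP -> ->; rewrite ?orbT.
  rewrite (hE _ r) ?(hE d r) ?(hE d' r); try by apply: cr; rewrite !inE eqxx ?orbT.
  rewrite scaler_sumr -big_split; apply: eq_bigr => s _.
  by rewrite dcoordP linearP.
by exists (lin hL).
Qed.

Lemma dsum_decomp W (i : S -> {linear W -> dsum W}) (d : dsum W) r :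
  (forall s w t, dcoord (i s w) t = if t == s then w else 0) ->
  covers r (dcoord d) -> d = \sum_(s <- r) i s (dcoord d s).
Proof.
move=> iE [u rP]; apply: dsum_ext => t; rewrite dcoord_sum.
have [tr|tr] := boolP (t \in r).
  rewrite (bigD1_seq t) //= iE eqxx big1 ?addr0 // => s /negPf st.
  by rewrite iE eq_sym st.
rewrite big_seq big1 => [|s sr]; last first.
  by rewrite iE; case: eqP => // ts; rewrite ts sr in tr.
by apply/eqP; apply: contraR tr => /rP.
Qed.

Lemma dmap_ex W W' (f : {linear W -> W'}) :
  exists h : {linear dsum W -> dsum W'},
    forall d s, dcoord (h d) s = f (dcoord d s).
Proof.
have /choice [h hE] : forall d : dsum W, exists d' : dsum W',
    dcoord d' = f \o dcoord d.
  move=> d; have [r [_ rP]] := covers_ex d; apply: (@dsum_mk _ _ r) => s.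
  by move=> nz; apply: rP; apply: contraNneq nz => e; rewrite /= e linear0.
have hL : linear h.
  by move=> a d d'; apply: dsum_ext => s; rewrite dcoordP !hE /= linearP.
by exists (lin hL) => d s; rewrite /= hE.
Qed.

Lemma dsum_projective P : projective P -> projective (dsum P).
Proof.
move=> Pp M N g h gS; have [i iE] := dinj_ex P.
have /choice [k kE] : forall s, exists k : {linear P -> M},
    forall x, g (k x) = h (i s x).
  by move=> s; apply: (Pp M N g (lcomp h (i s))).
have [l lE] := dsum_lift k; exists l => d; have [r rd] := covers_ex d.
rewrite (lE _ _ rd) [in RHS](dsum_decomp iE rd) !linear_sum /=.
by apply: eq_bigr => s _; rewrite kE.
Qed.

End FiniteSupport.

Definition free_cover (R : pzRingType) (M : lmodType R) : lmodType R :=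
  dsum M R^o.

Lemma free_cover_projective (R : pzRingType) (M : lmodType R) :
  projective (free_cover M).
Proof. exact/dsum_projective/projective_regular. Qed.

Lemma free_cover_surj (R : pzRingType) (M : lmodType R) :
  exists g : {linear free_cover M -> M}, surjective g.
Proof.
have [i iE] := @dinj_ex R M R^o.
have mulL (m : M) : linear (fun a : R^o => (a : R) *: m).
  by move=> a x y; rewrite scalerDl scalerA.
have [g gE] := dsum_lift (fun m => lin (mulL m)).
exists g => m; exists (i m 1); rewrite (gE _ [:: m]) ?big_seq1.
  by rewrite /= iE eqxx scale1r.
by split=> // t; rewrite iE inE; case: (t =P m) => // _; rewrite eqxx.
Qed.

(** * Dimension shifting *)

(** Two classes of linear maps [f : K -> L] are of interest: those along which all
maps to a fixed module extend (Ext), and those that stay injective under a fixed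
tensor product (Tor).  Dimension shifting uses only the rules below.  In
[mono_cross], [l] is the quotient map by the image of [K'] and [p] kills [K]; the
rule passes from the map [K' -> P] to the map [K -> L]. *)
Record mono_class (R : pzRingType)
    (Phi : forall K L : lmodType R, {linear K -> L} -> Prop) : Prop := {
  mono_id : forall K, Phi _ _ (lid K);
  mono_comp : forall (K L M : lmodType R) (f : {linear K -> L})
      (g : {linear L -> M}) (h : {linear K -> M}),
    (forall x, h x = g (f x)) -> Phi _ _ f -> Phi _ _ g -> Phi _ _ h;
  mono_left : forall (K L M : lmodType R) (f : {linear K -> L})
      (g : {linear L -> M}) (h : {linear K -> M}),
    (forall x, h x = g (f x)) -> Phi _ _ h -> Phi _ _ f;
  mono_cross : forall (K K' Q P L : lmodType R)
      (k : {linear K -> Q}) (p : {linear Q -> P})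
      (k' : {linear K' -> Q}) (l : {linear Q -> L})
      (u : {linear K' -> P}) (v : {linear K -> L}),
    exact k' l -> surjective l -> (forall x, p (k x) = 0) ->
    (forall x, u x = p (k' x)) -> (forall x, v x = l (k x)) ->
    Phi _ _ k -> Phi _ _ u -> Phi _ _ v
}.

Section Vanishing.
Variables (R : pzRingType).
Variable Phi : forall K L : lmodType R, {linear K -> L} -> Prop.
Hypothesis PhiP : mono_class Phi.
Implicit Types K L M N P Q T Z : lmodType R.

(** For the class of Ext this is the vanishing of [Ext^(i+1) (M, N)], for that of
Tor the vanishing of [Tor_(i+1) (V, M)]: degrees are shifted by one.  All
syzygies are quantified over, since then a syzygy of [M] can be chosen to fit the
argument; [vanish_syzygy] says that one of them is enough. *)
Fixpoint vanish (i : nat) (M : lmodType R) : Prop :=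
  match i with
  | 0 => forall (K L : lmodType R) (f : {linear K -> L}) (g : {linear L -> M}),
      short_exact f g -> Phi f
  | j.+1 => forall (K P : lmodType R) (f : {linear K -> P})
      (g : {linear P -> M}), projective P -> short_exact f g -> vanish j K
  end.

Lemma presentation_ex M :
  exists (K P : lmodType R) (f : {linear K -> P}) (g : {linear P -> M}),
    projective P /\ short_exact f g.
Proof.
have [g gS] := free_cover_surj M; have [K [k [kI kE]]] := kernel_ex g.
by exists K, (free_cover M), k, g; split; first exact: free_cover_projective.
Qed.

Lemma vanish_projective i P : projective P -> vanish i P.
Proof.
elim: i P => [|i IH] P Pp /= K L f g.
  move=> fg; have [r rf] := projective_retraction fg Pp.
  by apply: (mono_left PhiP (g := r) (h := lid K)) (mono_id PhiP K) => x; rewrite rf.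
move=> Lp fg; apply: IH; have [r rf] := projective_retraction fg Pp.
exact: (projective_retract rf).
Qed.

(** In positive degree, a presentation of [M] is enlarged to one of [Q] by adding a
free module; then the syzygy of [M] is a retract of that of [Q]. *)
Lemma vanish_retract i M Q (s : {linear M -> Q}) (r : {linear Q -> M}) :
  (forall x, r (s x) = x) -> vanish i Q -> vanish i M.
Proof.
elim: i M Q s r => [|i IH] M Q s r rs.
  move=> vQ K L f g fg; have [fI fE _] := fg.
  have [Z [z1 [z2 [k [kz z1k zc zE zI]]]]] := pullback_ses r fg.
  have [|w wE] := joint_lift (a := lid L) (b := lcomp s g) zI.
    by move=> y; apply: zE; rewrite /= rs.
  apply: (mono_left PhiP (g := w) (h := k)) (vQ _ _ _ _ kz) => x.
  have [w1 w2] := wE (f x); apply/eqP; rewrite -subr_eq0; apply/eqP.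
  have z2k : z2 (k x) = 0 by case: kz => _ kz _; apply: exact0.
  apply: zI; rewrite linearB ?z1k ?w1 ?z2k ?w2 /= ?subrr //.
  by rewrite (exact0 x fE) linear0 subrr.
move=> vQ K P f g Pp [fI fE gS].
have [c cS] := free_cover_surj Q; set F := free_cover Q in c cS.
have Fp : projective F by apply: free_cover_projective.
have [l lE] := Fp _ _ g (lcomp r c) gS.
pose cp := lcopair (lcomp s g) c.
have [W [w [wI wE]]] := kernel_ex cp.
have vW : vanish i W.
  apply: (vQ _ _ w cp); first exact: projective_prod.
  split=> // y; have [x <-] := cS y.
  by exists (0, x); rewrite /= !linear0 add0r.
have [|s' s'E] := lift_mono (h := lcomp (linl P F) f) wI.
  by move=> x; apply/wE; rewrite /= (exact0 x fE) !linear0 addr0.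
have [|r' r'E] := lift_mono (h := lcomp (lcopair (lid P) l) w) fI.
  move=> x; apply/fE; rewrite /= linearD lE /=.
  by have := congr1 r (exact0 x wE); rewrite /= linearD rs linear0.
apply: (IH K W s' r') vW => x; apply: fI.
by rewrite r'E /= s'E /= linear0 addr0.
Qed.

(** The inclusion [t] is the composite of two: into the preimage of [K], and from
this preimage into the whole of [E]. *)
Fact vanish0_extension K L M (f : {linear K -> L}) (g : {linear L -> M}) :
  short_exact f g -> vanish 0 K -> vanish 0 M -> vanish 0 L.
Proof.
move=> [fI fE gS] vK vM T E t e te; have [tI tE eS] := te.
have [Z [z1 [z2 [k [kz z1k zc zE zI]]]]] := pullback_ses f te.
have Phik : Phi k by apply: (vK _ _ _ _ kz).
apply: (mono_comp PhiP (f := k) (g := z1)) => //.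
apply: (vM _ _ z1 (lcomp g e)); split=> [|y|y].
- apply: linear_inj => z z0; apply: zI => //; apply: (inj0 fI).
  by rewrite -zc z0 linear0.
- split=> [/= /fE [x fx]|[z <-] /=]; last by rewrite zc; apply: exact0.
  by have [z [zy _]] := zE _ _ (esym fx); exists z.
- by have [x <-] := gS y; have [u <-] := eS x; exists u.
Qed.

(** The two statements are proved together.  The second one follows from the first
in the same degree: the pullback of [g] and a projective cover of [M] is an
extension of [L] by a syzygy of [M], and has [K] as a direct summand.  The first
one in degree [i.+1] follows from the second in degree [i]: a projective module
over [L] is also one over [M], and its two syzygies differ by [K]. *)
Fact vanish_extension_and_kernel i :
  (forall K L M (f : {linear K -> L}) (g : {linear L -> M}),
     short_exact f g -> vanish i K -> vanish i M -> vanish i L) /\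
  (forall K L M (f : {linear K -> L}) (g : {linear L -> M}),
     short_exact f g -> vanish i L -> vanish i.+1 M -> vanish i K).
Proof.
have shift j : (forall K L M (f : {linear K -> L}) (g : {linear L -> M}),
      short_exact f g -> vanish j K -> vanish j M -> vanish j L) ->
    forall K L M (f : {linear K -> L}) (g : {linear L -> M}),
     short_exact f g -> vanish j L -> vanish j.+1 M -> vanish j K.
  move=> ext K L M f g fg vL vM.
  have [S [Q [u [h [Qp uh]]]]] := presentation_ex M.
  have vS : vanish j S by apply: (vM _ _ u h).
  have [Z [z1 [z2 [k [kz z1k zc zE zI]]]]] := pullback_ses h fg.
  have [Z' [y1 [y2 [k' [kz' y1k yc yE yI]]]]] := pullback_ses g uh.
  have vZ' : vanish j Z' by apply: (ext _ _ _ _ _ kz').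
  have [a aE] : exists a : {linear Z -> Z'}, forall z, y1 (a z) = z2 z /\ y2 (a z) = z1 z.
    by apply: joint_lift => // z; apply: yE.
  have [b bE] : exists b : {linear Z' -> Z}, forall z, z1 (b z) = y2 z /\ z2 (b z) = y1 z.
    by apply: joint_lift => // z; apply: zE.
  have vZ : vanish j Z.
    apply: (vanish_retract (s := a) (r := b)) vZ' => z.
    have [[a1 a2] [b1 b2]] := (aE z, bE (a z)).
    by apply/eqP; rewrite -subr_eq0; apply/eqP/zI;
      rewrite linearB ?b1 ?b2 ?a1 ?a2 subrr.
  have [r rk] := projective_retraction kz Qp.
  exact: (vanish_retract rk).
elim: i => [|i [ext ker]].
  by split; [exact: vanish0_extension | apply/shift/vanish0_extension].
suff ext' : forall K L M (f : {linear K -> L}) (g : {linear L -> M}),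
     short_exact f g -> vanish i.+1 K -> vanish i.+1 M -> vanish i.+1 L.
  by split=> //; apply: shift.
move=> K L M f g [fI fE gS] vK vM T P t p Pp tp; have [tI tE pS] := tp.
have [W [w [wI wE]]] := kernel_ex (lcomp g p).
have vW : vanish i W.
  apply: (vM _ _ w (lcomp g p)) => //; split=> // y.
  by have [x <-] := gS y; have [u <-] := pS x; exists u.
have [|a aE] := lift_mono (h := t) wI.
  by move=> x; apply/wE; rewrite /= (exact0 x tE) linear0.
have [|b bE] := lift_mono (h := lcomp p w) fI.
  by move=> x; apply/fE; apply: (exact0 x wE).
apply: (ker _ _ _ a b) vW vK; split=> [x y e|y|y].
- by apply: tI; rewrite -!aE e.
- split=> [b0|[x <-]]; last first.
    by apply: (inj0 fI); rewrite bE /= aE (exact0 x tE).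
  have [|x tx] := (tE (w y)).1; first by rewrite -[LHS]bE b0 linear0.
  by exists x; apply: wI; rewrite aE.
- have [x px] := pS (f y); have [|z wz] := (wE x).1.
    by rewrite /= px; apply: exact0.
  by exists z; apply: fI; rewrite bE /= wz.
Qed.

Lemma vanish_extension i K L M (f : {linear K -> L}) (g : {linear L -> M}) :
  short_exact f g -> vanish i K -> vanish i M -> vanish i L.
Proof. by have [ext _] := vanish_extension_and_kernel i; apply: ext. Qed.

Lemma vanish_kernel i K L M (f : {linear K -> L}) (g : {linear L -> M}) :
  short_exact f g -> vanish i L -> vanish i.+1 M -> vanish i K.
Proof. by have [_ ker] := vanish_extension_and_kernel i; apply: ker. Qed.

(** The pullback of [g] and a projective cover of [M] is an extension of this
cover by [K], and an extension of [L] by the syzygy of [M]. *)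
Lemma vanish_cokernel i K L M (f : {linear K -> L}) (g : {linear L -> M}) :
  short_exact f g -> vanish i K -> vanish i.+1 L -> vanish i.+1 M.
Proof.
move=> fg vK vL W Q w q Qp wq.
have [Z [z1 [z2 [k [kz z1k zc zE zI]]]]] := pullback_ses q fg.
have vZ : vanish i Z by apply: (vanish_extension kz) => //; apply: vanish_projective.
have [Z' [y1 [y2 [k' [kz' y1k yc yE yI]]]]] := pullback_ses g wq.
have [a aE] : exists a : {linear Z' -> Z}, forall z, z1 (a z) = y2 z /\ z2 (a z) = y1 z.
  by apply: joint_lift => // z; apply: zE.
have [b bE] : exists b : {linear Z -> Z'}, forall z, y1 (b z) = z2 z /\ y2 (b z) = z1 z.
  by apply: joint_lift => // z; apply: yE.
apply: (vanish_kernel kz') vL.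
apply: (vanish_retract (s := a) (r := b)) vZ => z.
have [[a1 a2] [b1 b2]] := (aE z, bE (a z)).
by apply/eqP; rewrite -subr_eq0; apply/eqP/yI;
  rewrite linearB ?b1 ?b2 ?a1 ?a2 subrr.
Qed.

(** The same pullback, in the lowest degree; here the two extensions cross as in
[mono_cross]. *)
Lemma vanish0_cokernel K L M (f : {linear K -> L}) (g : {linear L -> M}) :
  short_exact f g -> Phi f -> vanish 0 L -> vanish 0 M.
Proof.
move=> fg Pf vL W Q w q wq; have [wI wE qS] := wq; have [fI fE gS] := fg.
have [Z [z1 [z2 [k [kz z1k zc zE zI]]]]] := pullback_ses g wq.
have kzP : Phi k by apply: (vL _ _ _ _ kz).
have [|k' k'E] := joint_lift (a := lzero K Q) (b := f) zI.
  by move=> x; apply: zE; rewrite linear0 (exact0 x fE).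
have k'z : exact k' z1.
  move=> z; split=> [z0|[x <-]]; last by case: (k'E x).
  have [|x fx] := (fE (z2 z)).1; first by rewrite -zc z0 linear0.
  exists x; have [e1 e2] := k'E x; apply/eqP; rewrite -subr_eq0; apply/eqP.
  by apply: zI; rewrite linearB ?e1 ?e2 ?z0 ?fx ?subrr.
apply: (mono_cross PhiP (k := k) (p := z2) (k' := k') (l := z1) (u := f)) => //.
- by move=> y; have [x xy] := gS (q y); have [z [<- _]] := zE _ _ (esym xy); exists z.
- by case: kz => _ kE _ x; apply: exact0.
- by move=> x; case: (k'E x).
Qed.

Lemma vanish0_presentation K P M (f : {linear K -> P}) (g : {linear P -> M}) :
  projective P -> short_exact f g -> Phi f -> vanish 0 M.
Proof.
by move=> Pp fg Pf; apply: vanish0_cokernel fg Pf _; apply: vanish_projective.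
Qed.

Lemma vanish_syzygy i K P M (f : {linear K -> P}) (g : {linear P -> M}) :
  projective P -> short_exact f g -> vanish i K -> vanish i.+1 M.
Proof.
by move=> Pp fg vK; apply: vanish_cokernel fg vK _; apply: vanish_projective.
Qed.

Lemma vanish_trivial i Z : trivial Z -> vanish i Z.
Proof.
move=> Z0; apply: vanish_projective => M N g h gS; exists (lzero Z M) => x.
by rewrite (Z0 x) !linear0.
Qed.

End Vanishing.

(** * Projective resolutions *)

Section Resolutions.
Variable R : pzRingType.
Implicit Types K L M N P Q T Z : lmodType R.

(** A projective resolution is built by choosing a presentation of every module
once and for all and iterating it. *)
Record presentation M := Presentation {
  pres_syzygy : lmodType R;
  pres_cover : lmodType R;
  pres_incl : {linear pres_syzygy -> pres_cover};
  pres_proj : {linear pres_cover -> M};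
  pres_projective : projective pres_cover;
  pres_ses : short_exact pres_incl pres_proj
}.

Fact presentation_inhabited M : exists p : presentation M, True.
Proof.
have [K [P [f [g [Pp fg]]]]] := presentation_ex M.
by exists (Presentation Pp fg).
Qed.

Definition pres M : presentation M :=
  sval (cid (presentation_inhabited M)).

Fixpoint syzygy (M : lmodType R) (i : nat) : lmodType R :=
  if i is j.+1 then pres_syzygy (pres (syzygy M j)) else M.

Lemma resolution_ex M :
  exists (P : nat -> lmodType R) (d : forall j, {linear P j.+1 -> P j})
         (e : {linear P 0 -> M}),
    (forall j, projective (P j)) /\ left_resolution d e.
Proof.
exists (fun j => pres_cover (pres (syzygy M j))).
exists (fun j => lcomp (pres_incl (pres (syzygy M j)))
                       (pres_proj (pres (syzygy M j.+1)))).
exists (pres_proj (pres M)); split=> [j|]; first exact: pres_projective.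
have step N (p : presentation N) T (h : {linear T -> pres_syzygy p}) :
    surjective h -> exact (lcomp (pres_incl p) h) (pres_proj p).
  move=> hS y; have [_ E _] := pres_ses p; split=> [/E [x <-]|[x <-]].
    by have [t <-] := hS x; exists t.
  by rewrite /= (exact0 _ E).
have pS N (p : presentation N) : surjective (pres_proj p).
  by have [_ _] := pres_ses p.
split=> [||i]; [exact: pS | exact/step/pS | ].
move=> y; have [iI _ _] := pres_ses (pres (syzygy M i)).
split=> [/(inj0 iI)|[x <-]]; first by move/(step _ _ _ _ (pS _ _) y).
by rewrite /= (exact0 _ (step _ _ _ _ (pS _ (pres (syzygy M i.+2))))) linear0.
Qed.

(** [Ext_eq0] and [Tor_eq0] speak of all resolutions of [M].  Putting a
presentation in front of a resolution of a syzygy, and removing the first term of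
a resolution, turn them into statements about syzygies. *)
Section Cons.
Variables (K P M : lmodType R) (f : {linear K -> P}) (g : {linear P -> M}).
Hypothesis fg : short_exact f g.
Variables (Q : nat -> lmodType R) (d : forall j, {linear Q j.+1 -> Q j}).
Variable e : {linear Q 0 -> K}.
Hypothesis dP : left_resolution d e.

Definition cons_obj (j : nat) : lmodType R := if j is i.+1 then Q i else P.

Definition cons_diff (j : nat) : {linear cons_obj j.+1 -> cons_obj j} :=
  match j return {linear cons_obj j.+1 -> cons_obj j} with
  | 0 => lcomp f e
  | i.+1 => d i
  end.

Lemma cons_resolution : left_resolution cons_diff (g : {linear cons_obj 0 -> M}).
Proof.
have [fI fE gS] := fg; have [eS d0 dE] := dP; split=> // [y|[|i]] //=.
  split=> [/fE [x <-]|[x <-]]; last by apply: exact0.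
  by have [q <-] := eS x; exists q.
move=> y; split=> [/(inj0 fI) /d0 //|[x <-]].
by rewrite /= (exact0 x d0) linear0.
Qed.

End Cons.

Lemma tail_resolution M (P : nat -> lmodType R)
    (d : forall j, {linear P j.+1 -> P j}) (e : {linear P 0 -> M}) :
  left_resolution d e ->
  exists (K : lmodType R) (k : {linear K -> P 0}) (e' : {linear P 1 -> K}),
    [/\ short_exact k e, forall x, k (e' x) = d 0 x
      & left_resolution (fun j => d j.+1) e'].
Proof.
move=> [eS d0 dE]; have [K [k [kI kE]]] := kernel_ex e.
have [|e' e'E] := lift_mono (h := d 0) kI; first by move=> x; apply/kE/exact0.
exists K, k, e'; split=> //; split=> [x||i]; last exact: dE.
  have [z dz] := (d0 (k x)).1 (exact0 x kE).
  by exists z; apply: kI; rewrite e'E.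
move=> y; rewrite -(dE 0 y) -e'E; split=> [->|/(inj0 kI) //].
by rewrite linear0.
Qed.

End Resolutions.

(** * Vanishing of Ext *)

Section Ext.
Variable R : pzRingType.
Implicit Types K L M N P Q T Z W : lmodType R.

Definition extends_to N K L (f : {linear K -> L}) : Prop :=
  forall h : {linear K -> N}, exists k : {linear L -> N}, forall x, k (f x) = h x.

Lemma extends_to_class N : mono_class (@extends_to N).
Proof.
split.
- by move=> K h; exists h.
- move=> K L M f g h hE Pf Pg a; have [b bE] := Pf a; have [c cE] := Pg b.
  by exists c => x; rewrite hE cE bE.
- move=> K L M f g h hE Ph a; have [b bE] := Ph a.
  by exists (lcomp b g) => x; rewrite -bE hE.
- move=> K K' Q P L k p k' l u v k'l lS pk uE vE Pk Pu h.
  have [a aE] := Pk h; have [b bE] := Pu (lcomp a k').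
  have [|c cE] := descend_epi (h := lsub a (lcomp b p)) lS.
    by move=> y /k'l [x <-]; rewrite /= -uE bE subrr.
  by exists c => x; rewrite vE cE /= pk linear0 subr0 aE.
Qed.

Notation ext_vanish N := (vanish (@extends_to N)).

Lemma Ext_eq0_vanish i M N : Ext_eq0 i.+1 M N -> ext_vanish N i M.
Proof.
elim: i M => [|i IH] M MN.
  have [P [d [e [Pp dP]]]] := resolution_ex M.
  have [K [k [e' [ke kd [e'S d1 _]]]]] := tail_resolution dP.
  apply: (vanish0_presentation (extends_to_class N) (Pp 0) ke) => h.
  have [x|c cE] := MN P d e Pp dP (lcomp h e').
    by rewrite /= (exact0 x d1) linear0.
  by exists c => y; have [x <-] := e'S y; rewrite kd -cE.
move=> K P f g Pp fg; apply: IH => Q d e Qp dP h h0.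
apply: (MN _ _ _ _ (cons_resolution fg dP) h h0).
by case=> //.
Qed.

Lemma vanish_Ext_eq0 i M N : ext_vanish N i M -> Ext_eq0 i.+1 M N.
Proof.
elim: i M => [|i IH] M vM P d e Pp dP; have [K [k [e' [ke kd e'P]]]] := tail_resolution dP.
  move=> h h0; have [e'S d1 _] := e'P.
  have [|a aE] := descend_epi (h := h) e'S; first by move=> x /d1 [y <-].
  have [c cE] := vM _ _ _ _ ke a; exists c => x.
  by rewrite -kd cE aE.
have vK : ext_vanish N i K by apply: (vM _ _ k e).
exact: (IH K vK _ _ _ (fun j => Pp j.+1) e'P).
Qed.

(** Pulling [N -> N''] back along [h] gives an extension of [K] by [N'], and a
splitting of it lifts [h]. *)
Lemma ext_vanish_lift N' N N'' (j : {linear N' -> N}) (q : {linear N -> N''}) K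
    (h : {linear K -> N''}) :
  short_exact j q -> ext_vanish N' 0 K ->
  exists k : {linear K -> N}, forall x, q (k x) = h x.
Proof.
move=> jq vK; have [_ jE _] := jq.
have [Z [z1 [z2 [k [kz z1k zc zE zI]]]]] := pullback_ses h jq.
have [r rk] := vK _ _ _ _ kz (lid N'); have [_ kE z2S] := kz.
have [|t tE] := descend_epi (h := lsub z1 (lcomp j r)) z2S.
  by move=> z /kE [x <-]; rewrite /= rk z1k subrr.
exists t => x; have [z <-] := z2S x.
by rewrite tE linearB /= (exact0 _ jE) subr0 zc.
Qed.

(** The piece [Ext^(i+1) (M, N) -> Ext^(i+1) (M, N'') -> Ext^(i+2) (M, N')] of the
long exact sequence in the second variable. *)
Lemma ext_vanish_quotient i N' N N'' (j : {linear N' -> N})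
    (q : {linear N -> N''}) M : short_exact j q ->
  ext_vanish N i M -> ext_vanish N' i.+1 M -> ext_vanish N'' i M.
Proof.
move=> jq; elim: i M => [|i IH] M vN vN'.
  have [K [P [f [g [Pp fg]]]]] := presentation_ex M.
  apply: (vanish0_presentation (extends_to_class N'') Pp fg) => h.
  have [k kE] := ext_vanish_lift h jq (vN' _ _ _ _ Pp fg).
  have [l lE] := vN _ _ _ _ fg k.
  by exists (lcomp q l) => x; rewrite /= lE kE.
move=> K P f g Pp fg; apply: IH; first exact: (vN _ _ f g).
exact: (vN' _ _ f g).
Qed.

Lemma ext_vanish_into_trivial i N M : trivial N -> ext_vanish N i M.
Proof.
move=> N0; elim: i M => [|i IH] M K L f g => [_ h|_ _]; last exact: IH.
by exists (lzero L N) => x; rewrite [RHS]N0.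
Qed.

Lemma dsum_ses (S : choiceType) K P W (f : {linear K -> P})
    (g : {linear P -> W}) : short_exact f g ->
  exists (f' : {linear dsum S K -> dsum S P}) (g' : {linear dsum S P -> dsum S W}),
    (forall d s, dcoord (f' d) s = f (dcoord d s)) /\ short_exact f' g'.
Proof.
move=> [fI fE gS]; have [f' f'E] := dmap_ex S f; have [g' g'E] := dmap_ex S g.
exists f', g'; split=> //; split=> [|d|d].
- apply: linear_inj => d d0; apply: dsum_ext => s; apply: (inj0 fI).
  by rewrite -f'E d0.
- split=> [d0|[x <-]]; last first.
    by apply: dsum_ext => s; rewrite g'E f'E (exact0 _ fE).
  have /choice [c cE] : forall s, exists x, f x = dcoord d s.
    by move=> s; apply/fE; rewrite -g'E d0.
  have [r [_ rP]] := covers_ex d; have [s|x xE] := dsum_mk (d := c) (r := r).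
    by move=> nz; apply: rP; apply: contraNneq nz => e; apply/eqP/(inj0 fI); rewrite cE.
  by exists x; apply: dsum_ext => s; rewrite f'E xE cE.
- have /choice [c cE] : forall s, exists x, g x = dcoord d s /\ (dcoord d s = 0 -> x = 0).
    move=> s; case: (eqVneq (dcoord d s) 0) => [->|nz].
      by exists 0; rewrite linear0.
    by have [x gx] := gS (dcoord d s); exists x; split=> // e; rewrite e eqxx in nz.
  have [r [_ rP]] := covers_ex d; have [s|x xE] := dsum_mk (d := c) (r := r).
    by move=> nz; apply: rP; apply: contraNneq nz => e; apply/eqP/(cE s).2.
  by exists x; apply: dsum_ext => s; rewrite g'E xE (cE s).1.
Qed.

(** A presentation of [W] gives one of its direct sum, and maps out of a direct sum
are extended on each summand separately. *)
Lemma ext_vanish_dsum (S : choiceType) i N W :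
  ext_vanish N i W -> ext_vanish N i (dsum S W).
Proof.
elim: i W => [|i IH] W vW; have [K [P [f [g [Pp fg]]]]] := presentation_ex W;
  have [f' [g' [f'E fg']]] := dsum_ses S fg; have dPp := dsum_projective (S := S) Pp.
  apply: (vanish0_presentation (extends_to_class N) dPp fg') => h.
  have [i iE] := @dinj_ex R S K.
  have /choice [k kE] : forall s, exists k : {linear P -> N}, forall x, k (f x) = h (i s x).
    by move=> s; have [k kE] := vW _ _ _ _ fg (lcomp h (i s)); exists k.
  have [l lE] := dsum_lift k; exists l => d; have [r rd] := covers_ex d.
  rewrite (lE _ r) => [|]; last first.
    case: rd => u rP; split=> // s nz; apply: rP.
    by apply: contraNneq nz => e; rewrite f'E e linear0.
  rewrite [in RHS](dsum_decomp iE rd) linear_sum.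
  by apply: eq_bigr => s _; rewrite f'E kE.
apply: (vanish_syzygy (extends_to_class N) dPp fg'); apply: IH.
exact: (vW _ _ f g).
Qed.

End Ext.

Notation ext_vanish N := (vanish (@extends_to _ N)).

(** * Tensor products and vanishing of Tor *)

Section TensorMaps.
Variables (A B : pzRingType) (V : bimodType A B).
Implicit Types K L M N P Q Y : lmodType B.

Definition tmap_list (S T : Type) (h : S -> T) (s : seq (V * S)) : seq (V * T) :=
  [seq (p.1, h p.2) | p <- s].

Lemma tensor_map_tcls Y M (h : {linear Y -> M}) s :
  tensor_map V h (tcls s) = tcls (tmap_list h s).
Proof. by rewrite /tensor_map /= tlift_tcls tcls_sum big_map. Qed.

Lemma tensor_map_pure Y M (h : {linear Y -> M}) v y :
  tensor_map V h (pure v y) = pure v (h y).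
Proof. exact: tlift_pure. Qed.

Lemma tensor_ext Y (X : lmodType A) (f g : {linear tensor V Y -> X}) :
  (forall v y, f (pure v y) = g (pure v y)) -> f =1 g.
Proof.
move=> fg; elim/tensor_ind => s; rewrite tcls_sum !linear_sum.
by apply: eq_bigr => p _; apply: fg.
Qed.

Lemma tensor_map_id Y (h : {linear Y -> Y}) x :
  (forall y, h y = y) -> tensor_map V h x = x.
Proof.
move=> hE; apply: (tensor_ext (f := tensor_map V h) (g := lid _)) => v y.
by rewrite tensor_map_pure hE.
Qed.

Lemma tensor_map_comp Y M N (f : {linear Y -> M}) (g : {linear M -> N})
    (h : {linear Y -> N}) x : (forall y, h y = g (f y)) ->
  tensor_map V h x = tensor_map V g (tensor_map V f x).
Proof.
move=> hE; pose gf := lcomp (tensor_map V g) (tensor_map V f).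
apply: (tensor_ext (f := tensor_map V h) (g := gf)) => v y.
by rewrite /= !tensor_map_pure hE.
Qed.

Lemma pure0 Y (v : V) : pure v (0 : Y) = 0.
Proof. by apply: (addrI (pure v (0 : Y))); rewrite -pureDr !addr0. Qed.

Lemma tensor_map0 Y M (h : {linear Y -> M}) x :
  (forall y, h y = 0) -> tensor_map V h x = 0.
Proof.
move=> h0; apply: (tensor_ext (f := tensor_map V h) (g := lzero _ _)) => v y.
by rewrite tensor_map_pure h0 pure0.
Qed.

Lemma tensor_map_surj Y M (h : {linear Y -> M}) :
  surjective h -> surjective (tensor_map V h).
Proof.
move=> /choice [s hs]; elim/tensor_ind=> t; exists (tcls (tmap_list s t)).
rewrite tensor_map_tcls /tmap_list -map_comp -[in RHS](map_id t); congr tcls.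
by apply: eq_map => -[v y] /=; rewrite hs.
Qed.

(** Exactness in the middle is the point: the classes of two lists over [L] that
become congruent over [N] differ by an element of the image of [V (x) K], by
induction on the congruence. *)
Lemma tensor_right_exact K L N (f : {linear K -> L}) (g : {linear L -> N}) :
  exact f g -> surjective g -> exact (tensor_map V f) (tensor_map V g).
Proof.
move=> fg gS; pose I x := exists k, tensor_map V f k = x.
have I0 : I 0 by exists 0; rewrite linear0.
have ID x y : I x -> I y -> I (x + y).
  by move=> [k <-] [l <-]; exists (k + l); rewrite linearD.
have IN x : I x -> I (- x) by move=> [k <-]; exists (- k); rewrite linearN.
have Ipure v y z : g y = g z -> I (pure v y - pure v z).
  move=> e; have [|k fk] := (fg (y - z)).1; first by rewrite linearB e subrr.
  by exists (pure v k); apply/eqP; rewrite eq_sym subr_eq tensor_map_pure fk -pureDr subrK.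
have lift (s : seq (V * N)) : exists s', tmap_list g s' = s.
  elim: s => [|[v n] s [s' IH]]; first by exists [::].
  by have [y gy] := gS n; exists ((v, y) :: s'); rewrite /= gy IH.
have Isame s' t' : tmap_list g s' = tmap_list g t' -> I (tcls s' - tcls t').
  elim: s' t' => [|[v y] s' IH] [|[w z] t'] //= => [_|[<- yz e]].
    by rewrite subrr.
  rewrite -[_ :: s']/([:: _] ++ s') -[_ :: t']/([:: _] ++ t') -!tclsD.
  by rewrite opprD addrACA; apply: ID; [apply: Ipure | apply: IH].
(* The cases of the induction cut a list over L where its image is cut. *)
have split_list s' s t : tmap_list g s' = s ++ t ->
    exists a b, [/\ s' = a ++ b, tmap_list g a = s & tmap_list g b = t].
  move=> e; exists (take (size s) s'), (drop (size s) s').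
  rewrite /tmap_list map_take map_drop -/(tmap_list g s') e.
  by rewrite cat_take_drop take_size_cat ?drop_size_cat.
have Ieq s t : teq s t -> forall s' t', tmap_list g s' = s ->
    tmap_list g t' = t -> I (tcls s' - tcls t').
  elim=> {s t} [s|s t _ IH|s t r _ IHs _ IHt|s1 s2 t1 t2 _ IH1 _ IH2|s t|
    n|v w n|v n n'|v b n] s' t'.
  - by move=> <- e; apply: Isame.
  - by move=> es et; rewrite -opprB; apply/IN/IH.
  - move=> es er; have [t'' et] := lift t.
    by rewrite -(subrK (tcls t'') (tcls s')) -addrA; apply: ID; [apply: IHs | apply: IHt].
  - move=> /split_list [a [b [-> ea eb]]] /split_list [c [d [-> ec ed]]].
    by rewrite -!tclsD opprD addrACA; apply: ID; [apply: IH1 | apply: IH2].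
  - move=> /split_list [a [b [-> ea eb]]] /split_list [c [d [-> ec ed]]].
    rewrite -!tclsD [tcls c + _]addrC opprD addrACA.
    by apply: ID; apply: Isame; rewrite ?ea ?eb.
  - case: s' => [|[v y] [|? ?]] //= [-> _]; case: t' => //= _.
    have /tclsP -> := teq_zero V y; have -> : tcls [::] = 0 :> tensor V L by [].
    by rewrite subrr.
  - case: s' => [|[u y] [|? ?]] //= [-> yn].
    case: t' => [|[v' y1] [|[w' y2] [|? ?]]] //= [-> y1n -> y2n].
    rewrite -[tcls [:: (v, y1); _]](tclsD [:: _] [:: _]).
    rewrite -[tcls [:: (v + w, y)]]/(pure (v + w) y) pureDl opprD addrACA.
    by apply: ID; apply: Ipure; rewrite yn.
  - case: s' => [|[u y] [|? ?]] //= [-> yn].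
    case: t' => [|[v' y1] [|[w' y2] [|? ?]]] //= [-> y1n -> y2n].
    rewrite -[tcls [:: (v, y1); _]](tclsD [:: _] [:: _]).
    rewrite -[tcls [:: (v, y1)]]/(pure v y1) -[tcls [:: (v, y2)]]/(pure v y2).
    by rewrite -pureDr; apply: Ipure; rewrite yn linearD y1n y2n.
  - case: s' => [|[u y] [|? ?]] //= [-> yn].
    case: t' => [|[v' z] [|? ?]] //= [-> zn].
    rewrite -[tcls [:: (_, y)]]/(pure (ract v b) y) pure_bal.
    by apply: Ipure; rewrite linearZ /= yn zn.
move=> x; split=> [|[k <-]]; last first.
  by rewrite -(tensor_map_comp (h := lzero K N)) ?tensor_map0 // => y; rewrite (exact0 y fg).
elim/tensor_ind: x => s; rewrite tensor_map_tcls => /(@tclsP _ _ V N _ [::]).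
by move=> /Ieq /(_ s [::] erefl erefl); rewrite subr0.
Qed.

End TensorMaps.

Section Tor.
Variables (A B : pzRingType) (V : bimodType A B).
Implicit Types K L M N P Q Y : lmodType B.

Definition stays_injective K L (f : {linear K -> L}) : Prop :=
  injective (tensor_map V f).

Lemma stays_injective_class : mono_class stays_injective.
Proof.
split.
- by move=> K x y; rewrite !tensor_map_id.
- move=> K L M f g h hE fI gI x y.
  by rewrite !(tensor_map_comp (f := f) (g := g) (h := h)) // => /gI /fI.
- move=> K L M f g h hE hI x y e; apply: hI.
  by rewrite !(tensor_map_comp (f := f) (g := g) (h := h)) // e.
- move=> K K' Q P L k p k' l u v k'l lS pk uE vE kI uI.
  (* An element of V (x) K that is zero in V (x) L agrees in V (x) Q with one of
     V (x) K'.  The latter is zero in V (x) P because p kills K. *)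
  apply: linear_inj => x vx; apply: (inj0 kI).
  have k'lV := tensor_right_exact (V := V) k'l lS.
  have [|z zE] := (k'lV (tensor_map V k x)).1.
    by rewrite -(tensor_map_comp (h := v)).
  rewrite -zE; suff -> : z = 0 by rewrite linear0.
  apply: (inj0 uI); rewrite (tensor_map_comp (f := k') (g := p)) // zE.
  by rewrite -(tensor_map_comp (h := lzero K P)) // tensor_map0.
Qed.

Notation tor_vanish := (vanish stays_injective).

Lemma Tor_eq0_vanish i Y : Tor_eq0 i.+1 V Y -> tor_vanish i Y.
Proof.
elim: i Y => [|i IH] Y VY.
  have [P [d [e [Pp dP]]]] := resolution_ex Y.
  have [K [k [e' [ke kd [e'S d1 _]]]]] := tail_resolution dP.
  apply: (vanish0_presentation stays_injective_class (Pp 0) ke).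
  apply: linear_inj => x kx; have [z zx] := tensor_map_surj (V := V) e'S x.
  have [|w wz] := (VY P d e Pp dP z).1.
    by rewrite (tensor_map_comp (f := e') (g := k)) ?zx.
  rewrite -zx -wz -(tensor_map_comp (h := lzero _ K)) ?tensor_map0 //.
  by move=> y; rewrite (exact0 y d1).
move=> K P f g Pp fg; apply: IH => Q d e Qp dP.
apply: (VY _ _ _ _ (cons_resolution fg dP)).
by case=> //.
Qed.

Lemma tor_vanish_ses K Y Y' (f : {linear K -> Y}) (g : {linear Y -> Y'}) :
  short_exact f g -> tor_vanish 0 Y' ->
  short_exact (tensor_map V f) (tensor_map V g).
Proof.
move=> fg vY; have [_ fE gS] := fg.
split; [exact: (vY _ _ f g) | exact: tensor_right_exact | exact: tensor_map_surj].
Qed.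

End Tor.

Notation tor_vanish V := (vanish (@stays_injective _ _ V)).

(** * Finite resolutions and coresolutions *)

Section FiniteResolutions.
Variable R : pzRingType.
Implicit Types K L M N P Q T Z : lmodType R.
Variable C : lmodType R -> Prop.

(** Recursive forms of [wedge] and [vee].  The parameter counts the terms of the
(co)resolution, so that the zero module is the base case and, when [C] contains
the zero modules, [wedge C m] is [resolved C m.+1]. *)
Fixpoint resolved (m : nat) (M : lmodType R) : Prop :=
  match m with
  | 0 => trivial M
  | j.+1 => exists (K X : lmodType R) (f : {linear K -> X}) (g : {linear X -> M}),
      [/\ short_exact f g, C X & resolved j K]
  end.

Fixpoint coresolved (m : nat) (M : lmodType R) : Prop :=
  match m with
  | 0 => trivial M
  | j.+1 => exists (X K : lmodType R) (f : {linear M -> X}) (g : {linear X -> K}),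
      [/\ short_exact f g, C X & coresolved j K]
  end.

Section RightCons.
Variables (M X K : lmodType R) (f : {linear M -> X}) (g : {linear X -> K}).
Hypothesis fg : short_exact f g.
Variables (I : nat -> lmodType R) (d : forall j, {linear I j -> I j.+1}).
Variable e : {linear K -> I 0}.
Hypothesis dP : right_resolution d e.

Definition cocons_diff (j : nat) :
    {linear cons_obj X I j -> cons_obj X I j.+1} :=
  match j return {linear cons_obj X I j -> cons_obj X I j.+1} with
  | 0 => lcomp e g
  | i.+1 => d i
  end.

Lemma cocons_resolution :
  right_resolution cocons_diff (f : {linear M -> cons_obj X I 0}).
Proof.
have [fI fE gS] := fg; have [eI d0 dE] := dP; split=> // [y|[|i]] //=.
  by split=> [/(inj0 eI) /fE //|/fE /= ->]; rewrite linear0.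
move=> y; split=> [/d0 [x <-]|[x <-]]; last by rewrite /= (exact0 _ d0).
by have [z <-] := gS x; exists z.
Qed.

End RightCons.

Lemma cotail_resolution M (I : nat -> lmodType R)
    (d : forall j, {linear I j -> I j.+1}) (e : {linear M -> I 0}) :
  right_resolution d e ->
  exists (K : lmodType R) (g : {linear I 0 -> K}) (k : {linear K -> I 1}),
    short_exact e g /\ right_resolution (fun j => d j.+1) k.
Proof.
move=> [eI d0 dE]; have [K [k [kI kE]]] := kernel_ex (d 1).
have [|g gE] := lift_mono (h := d 0) kI.
  by move=> x; apply/kE/(exact0 x (dE 0)).
exists K, g, k; split; last by split=> // i; apply: dE.
split=> // [y|z]; last first.
  have [x dx] := (dE 0 (k z)).1 (exact0 z kE).
  by exists x; apply: kI; rewrite gE.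
by rewrite -(d0 y) -gE; split=> [->|/(inj0 kI) //]; rewrite linear0.
Qed.

Lemma resolved_resolution m M : resolved m M ->
  exists (X : nat -> lmodType R) (d : forall i, {linear X i.+1 -> X i})
         (e : {linear X 0 -> M}),
    [/\ left_resolution d e, forall i, (i < m)%N -> C (X i)
      & forall i, (m <= i)%N -> trivial (X i)].
Proof.
elim: m M => [|m IH] M /= => [M0|[K [X [f [g [fg CX /IH]]]]]].
  exists (fun _ => M), (fun _ => lzero M M), (lid M); split=> //; split=> [x||i].
  - by exists x.
  - by move=> y; split=> [_|_]; [exists 0; rewrite (M0 y) | rewrite (M0 y)].
  - by move=> y; split=> [_|_]; [exists 0; rewrite (M0 y) | rewrite (M0 y)].
move=> [Q [d [e [dP CQ Q0]]]].
exists (cons_obj X Q), (cons_diff f d e), g.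
by split=> [|[|i]|[|i]] //; [apply: cons_resolution | apply: CQ | apply: Q0].
Qed.

Lemma resolution_resolved m M (X : nat -> lmodType R)
    (d : forall i, {linear X i.+1 -> X i}) (e : {linear X 0 -> M}) :
  left_resolution d e -> (forall i, (i < m)%N -> C (X i)) ->
  (forall i, (m <= i)%N -> trivial (X i)) -> resolved m M.
Proof.
elim: m M X d e => [|m IH] M X d e dP CX X0.
  move=> x; have [eS _ _] := dP; have [y <-] := eS x.
  by rewrite (X0 0 _ y) ?linear0.
have [K [k [e' [ke _ e'P]]]] := tail_resolution dP.
exists K, (X 0), k, e; split=> //; first exact: CX.
by apply: (IH K _ _ _ e'P) => i im; [apply: CX | apply: X0].
Qed.

Lemma coresolved_resolution m M : coresolved m M ->
  exists (X : nat -> lmodType R) (d : forall i, {linear X i -> X i.+1})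
         (e : {linear M -> X 0}),
    [/\ right_resolution d e, forall i, (i < m)%N -> C (X i)
      & forall i, (m <= i)%N -> trivial (X i)].
Proof.
elim: m M => [|m IH] M /= => [M0|[X [K [f [g [fg CX /IH]]]]]].
  exists (fun _ => M), (fun _ => lzero M M), (lid M); split=> //; split=> [//||i].
  - by move=> y; split=> [_|_] //; exists y.
  - by move=> y; split=> [_|_]; [exists 0; rewrite (M0 y) | rewrite (M0 y)].
move=> [Q [d [e [dP CQ Q0]]]].
exists (cons_obj X Q), (cocons_diff g d e), f.
by split=> [|[|i]|[|i]] //; [apply: cocons_resolution | apply: CQ | apply: Q0].
Qed.

Lemma resolution_coresolved m M (X : nat -> lmodType R)
    (d : forall i, {linear X i -> X i.+1}) (e : {linear M -> X 0}) :
  right_resolution d e -> (forall i, (i < m)%N -> C (X i)) ->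
  (forall i, (m <= i)%N -> trivial (X i)) -> coresolved m M.
Proof.
elim: m M X d e => [|m IH] M X d e dP CX X0.
  by move=> x; have [eI _ _] := dP; apply: (inj0 eI); apply: X0.
have [K [g [k [eg kP]]]] := cotail_resolution dP.
exists (X 0), K, e, g; split=> //; first exact: CX.
by apply: (IH K _ _ _ kP) => i im; [apply: CX | apply: X0].
Qed.

Hypothesis C0 : forall Z, trivial Z -> C Z.

Lemma wedge_resolved m M : wedge C m M <-> resolved m.+1 M.
Proof.
split=> [[k [X [d [e [km dP CX X0]]]]]|/resolved_resolution].
  apply: (resolution_resolved dP) => i im; last by apply: X0; apply: leq_ltn_trans im.
  by case: (leqP i k) => [/CX //|/X0 /C0].
by move=> [X [d [e [dP CX X0]]]]; exists m, X, d, e.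
Qed.

Lemma vee_coresolved m M : vee C m M <-> coresolved m.+1 M.
Proof.
split=> [[k [X [d [e [km dP CX X0]]]]]|/coresolved_resolution].
  apply: (resolution_coresolved dP) => i im; last by apply: X0; apply: leq_ltn_trans im.
  by case: (leqP i k) => [/CX //|/X0 /C0].
by move=> [X [d [e [dP CX X0]]]]; exists m, X, d, e.
Qed.

End FiniteResolutions.

(** * Hom and tensor product along finite (co)resolutions *)

Section HomTensor.
Variables (A B : pzRingType) (V : bimodType A B).

Lemma bhom_ses (K L M : lmodType A) (f : {linear K -> L}) (g : {linear L -> M}) :
  short_exact f g -> ext_vanish K 0 V ->
  short_exact (bhom_map V f) (bhom_map V g).
Proof.
move=> fg vV; have [fI fE gS] := fg; split=> [|h|h].
- apply: linear_inj => h h0; apply: bhom_ext => v; apply: (inj0 fI).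
  by have := congr1 (fun k => bhom_fun k v) h0.
- split=> [h0|[k <-]]; last by apply: bhom_ext => v; apply: (exact0 _ fE).
  have [|k kE] := lift_mono (h := bhom_fun h) fI.
    by move=> v; apply/fE; have := congr1 (fun k => bhom_fun k v) h0.
  by exists k; apply: bhom_ext.
- have [k kE] := ext_vanish_lift (bhom_fun h) fg vV.
  by exists k; apply: bhom_ext.
Qed.

Variable n : nat.
Variables (C : lmodType A -> Prop) (D : lmodType B -> Prop).

(** Each step of the resolution costs one degree of the vanishing of [Ext (V, -)].
With at most [n] steps, enough is left for [Hom (V, -)] to keep the resolution
exact. *)
Lemma resolved_bhom m (Z : lmodType A) :
  (forall i X, (i < n)%N -> C X -> ext_vanish X i V) ->
  (forall X, C X -> D (bhom V X)) -> (m <= n)%N -> resolved C m Z ->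
  (forall i, (i + m < n)%N -> ext_vanish Z i V) /\ resolved D m (bhom V Z).
Proof.
move=> CV CD; elim: m Z => [|m IH] Z mn /=.
  move=> Z0; split=> [i _|h]; first exact: ext_vanish_into_trivial.
  by apply: bhom_ext => v; apply: Z0.
move=> [K [X [f [g [fg CX /IH [|vK DK]]]]]]; first exact: ltnW.
split=> [i im|].
  apply: (ext_vanish_quotient fg); last by apply: vK; rewrite addSnnS.
  by apply: CV => //; apply: leq_ltn_trans im; apply: leq_addr.
exists (bhom V K), (bhom V X), (bhom_map V f), (bhom_map V g).
by split=> //; [apply: bhom_ses => //; apply: vK | apply: CD].
Qed.

Lemma coresolved_tensor m (Z : lmodType B) :
  (forall i Y, (i < n)%N -> D Y -> tor_vanish V i Y) ->
  (forall Y, D Y -> C (tensor V Y)) -> (m <= n)%N -> coresolved D m Z ->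
  (forall i, (i + m < n)%N -> tor_vanish V i Z) /\ coresolved C m (tensor V Z).
Proof.
move=> DV DC; elim: m Z => [|m IH] Z mn /=.
  move=> Z0; split=> [i _|x].
    exact: (vanish_trivial (stays_injective_class V)).
  by rewrite -[x](tensor_map_id (h := lid Z)) // tensor_map0.
move=> [X [K [f [g [fg DX /IH [|vK CK]]]]]]; first exact: ltnW.
split=> [i im|].
  apply: (vanish_kernel (stays_injective_class V) fg); last by apply: vK; rewrite addSnnS.
  by apply: DV => //; apply: leq_ltn_trans im; apply: leq_addr.
exists (tensor V X), (tensor V K), (tensor_map V f), (tensor_map V g).
by split=> //; [apply: tor_vanish_ses => //; apply: vK | apply: DC].
Qed.

End HomTensor.

(** * The Morita ring seen from a corner *)

(** The Morita ring together with its two corners, in a form that is symmetric in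
[A] and [B].  An element [m] of a module is [tin (tout m) + bin (bout m)], and
[view_act] is the action of a matrix on such a column; [vf], [vg] are the structure
maps with values in Hom modules, and [vF], [vG] their adjoints on tensor products.
The bottom corner of a view is the top corner of [swap_view], so that an argument
about one corner or one structure map serves for both. *)
Record morita_view (A B : pzRingType) (V : bimodType A B) (U : bimodType B A) :=
  MoritaView {
  mv_ring :> pzRingType;
  entries : mv_ring -> morita0 V U;
  of_entries : morita0 V U -> mv_ring;
  entriesK : cancel of_entries entries;
  of_entriesK : cancel entries of_entries;
  entriesD : {morph entries : x y / x + y};
  entriesM : {morph entries : x y / x * y};
  entries1 : entries 1 = 1;
  top : lmodType mv_ring -> lmodType A;
  bot : lmodType mv_ring -> lmodType B;
  tin : forall M, top M -> M;
  bin : forall M, bot M -> M;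
  tout : forall M : lmodType mv_ring, M -> top M;
  bout : forall M : lmodType mv_ring, M -> bot M;
  tin_inj : forall M, injective (@tin M);
  bin_inj : forall M, injective (@bin M);
  tinD : forall M, {morph @tin M : x y / x + y};
  binD : forall M, {morph @bin M : x y / x + y};
  top_bot : forall (M : lmodType mv_ring) (m : M), tin (tout m) + bin (bout m) = m;
  vf : forall M, {linear top M -> bhom U (bot M)};
  vg : forall M, {linear bot M -> bhom V (top M)};
  vF : forall M, {linear tensor U (top M) -> bot M};
  vG : forall M, {linear tensor V (bot M) -> top M};
  vF_pure : forall M u x, vF M (pure u x) = bhom_fun (vf M x) u;
  vG_pure : forall M v y, vG M (pure v y) = bhom_fun (vg M y) v;
  view_act : forall (M : lmodType mv_ring) (l : mv_ring) (x : top M) (y : bot M),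
    l *: (tin x + bin y) =
    tin ((entries l).1.1 *: x + bhom_fun (vg M y) (entries l).1.2) +
    bin (bhom_fun (vf M x) (entries l).2.1 + (entries l).2.2 *: y)
}.

Section Swap.
Variables (A B : pzRingType) (V : bimodType A B) (U : bimodType B A).
Variable S : morita_view V U.

Definition swap_entries (C D : pzRingType) (W : bimodType C D)
  (T : bimodType D C) (x : morita0 W T) : morita0 T W :=
  mor_mx x.2.2 x.2.1 x.1.2 x.1.1.

Definition swap_view : morita_view U V.
Proof.
refine (@MoritaView _ _ U V S (fun x => swap_entries (entries x))
  (fun x => of_entries S (swap_entries x)) _ _ _ _ _
  (@bot _ _ _ _ S) (@top _ _ _ _ S) (@bin _ _ _ _ S) (@tin _ _ _ _ S)
  (@bout _ _ _ _ S) (@tout _ _ _ _ S)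
  (@bin_inj _ _ _ _ S) (@tin_inj _ _ _ _ S)
  (@binD _ _ _ _ S) (@tinD _ _ _ _ S) _ (@vg _ _ _ _ S) (@vf _ _ _ _ S)
  (@vG _ _ _ _ S) (@vF _ _ _ _ S)
  (@vG_pure _ _ _ _ S) (@vF_pure _ _ _ _ S) _).
- by move=> [[b u] [v a]]; rewrite entriesK.
- move=> x; rewrite -[RHS]of_entriesK.
  by case: (entries x) => [[? ?] [? ?]].
- by move=> x y; rewrite entriesD.
- move=> x y; rewrite entriesM.
  move: (entries x) (entries y) => [[a1 v1] [u1 b1]] [[a2 v2] [u2 b2]].
  by rewrite /swap_entries /mor_mx /=; congr ((_, _), (_, _)); rewrite addrC.
- by rewrite entries1.
- by move=> M m; rewrite addrC top_bot.
- by move=> M l y x; rewrite addrC view_act addrC ![bhom_fun _ _ + _]addrC.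
Defined.

End Swap.

Section Standard.
Variables (A B : pzRingType) (V : bimodType A B) (U : bimodType B A).

Fact std_top_bot (M : lmodType (morita0 V U)) (m : M) :
  in11 V U 1 *: m + in22 V U 1 *: m = m.
Proof.
rewrite -scalerDl -[RHS]scale1r; congr (_ *: _).
by rewrite /in11 /in22 mor_mxD !addr0 !add0r.
Qed.

Fact std_act (M : lmodType (morita0 V U)) (l : morita0 V U) (x : mod_top M)
    (y : mod_bot M) :
  l *: (val x + val y) =
  val (l.1.1 *: x + bhom_fun (adj_g M y) l.1.2) +
  val (bhom_fun (adj_f M x) l.2.1 + l.2.2 *: y).
Proof.
case: l => [[a v] [u b]]; rewrite scalerDr -[in LHS](topP x) -[in LHS](botP y).
rewrite !scalerA -/(mor_mx a v u b) /in11 /in22 !mor_mxM.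
rewrite !mulr0 !mulr1 !scaler0 !ract0r !ract1 !addr0 !add0r.
have -> : mor_mx a 0 u 0 = in11 V U a + in21 V u.
  by rewrite /in11 /in21 mor_mxD !addr0 !add0r.
have -> : mor_mx 0 v 0 b = in12 U v + in22 V U b.
  by rewrite /in12 /in22 mor_mxD !addr0 !add0r.
by rewrite !scalerDl !raddfD /= addrACA.
Qed.

Definition std_tout (M : lmodType (morita0 V U)) (m : M) : mod_top M :=
  exist _ (in11 V U 1 *: m) (top_11 1 m).
Definition std_bout (M : lmodType (morita0 V U)) (m : M) : mod_bot M :=
  exist _ (in22 V U 1 *: m) (bot_22 1 m).

Definition std_tin (M : lmodType (morita0 V U)) (x : mod_top M) : M := val x.
Definition std_bin (M : lmodType (morita0 V U)) (y : mod_bot M) : M := val y.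

Fact std_tin_inj M : injective (@std_tin M). Proof. exact: val_inj. Qed.
Fact std_bin_inj M : injective (@std_bin M). Proof. exact: val_inj. Qed.
Fact std_tinD M : {morph @std_tin M : x y / x + y}. Proof. by []. Qed.
Fact std_binD M : {morph @std_bin M : x y / x + y}. Proof. by []. Qed.

Fact std_F_pure (M : lmodType (morita0 V U)) u (x : mod_top M) :
  str_f M (pure u x) = bhom_fun (adj_f M x) u.
Proof. exact: tlift_pure. Qed.

Fact std_G_pure (M : lmodType (morita0 V U)) v (y : mod_bot M) :
  str_g M (pure v y) = bhom_fun (adj_g M y) v.
Proof. exact: tlift_pure. Qed.

Definition std_view : morita_view V U :=
  @MoritaView _ _ V U (morita0 V U) id id (fun=> erefl) (fun=> erefl) (fun _ _ => erefl)
    (fun _ _ => erefl) erefl (fun M => mod_top M) (fun M => mod_bot M)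
    std_tin std_bin std_tout std_bout std_tin_inj std_bin_inj
    std_tinD std_binD std_top_bot
    (@adj_f _ _ V U) (@adj_g _ _ V U) (@str_f _ _ V U) (@str_g _ _ V U)
    std_F_pure std_G_pure std_act.

End Standard.

(** * Modules over the Morita ring *)

Section Corner.
Variables (A B : pzRingType) (V : bimodType A B) (U : bimodType B A).
Variable S : morita_view V U.
Implicit Types K M N P : lmodType S.

Lemma tin_zero M : tin (0 : top M) = 0.
Proof. by apply: (addrI (tin (0 : top M))); rewrite -tinD !addr0. Qed.

Lemma bin_zero M : bin (0 : bot M) = 0.
Proof. by apply: (addrI (bin (0 : bot M))); rewrite -binD !addr0. Qed.

Lemma view_act_mx M a v u b (x : top M) (y : bot M) :
  of_entries S (mor_mx a v u b) *: (tin x + bin y) =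
  tin (a *: x + bhom_fun (vg M y) v) + bin (bhom_fun (vf M x) u + b *: y).
Proof. by rewrite view_act entriesK. Qed.

Definition idem1 : S := of_entries S (mor_mx 1 0 0 0).

Lemma idem1_act M (x : top M) (y : bot M) : idem1 *: (tin x + bin y) = tin x.
Proof. by rewrite view_act_mx scale1r scale0r !linear0 !addr0 bin_zero addr0. Qed.

Lemma idem1E M (m : M) : idem1 *: m = tin (tout m).
Proof. by rewrite -[in LHS](top_bot m) idem1_act. Qed.

Lemma top_bot_inj M (x x' : top M) (y y' : bot M) :
  tin x + bin y = tin x' + bin y' -> x = x' /\ y = y'.
Proof.
move=> e; have ex : x = x'.
  by apply: tin_inj; rewrite -(idem1_act x y) e idem1_act.
by split=> //; apply: bin_inj; move: e; rewrite ex => /addrI.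
Qed.

Lemma tout_split M (x : top M) (y : bot M) : tout (tin x + bin y) = x.
Proof. by have [] := top_bot_inj (top_bot (tin x + bin y)). Qed.

Lemma bout_split M (x : top M) (y : bot M) : bout (tin x + bin y) = y.
Proof. by have [] := top_bot_inj (top_bot (tin x + bin y)). Qed.

Lemma tinK M (x : top M) : tout (tin x) = x.
Proof. by rewrite -[tin x]addr0 -bin_zero tout_split. Qed.

Lemma tin_act M a u (x : top M) :
  of_entries S (mor_mx a 0 u 0) *: tin x = tin (a *: x) + bin (bhom_fun (vf M x) u).
Proof.
by rewrite -[tin x]addr0 -bin_zero view_act_mx !linear0 ?scaler0 !addr0.
Qed.

Lemma tinZ M a (x : top M) : tin (a *: x) = of_entries S (mor_mx a 0 0 0) *: tin x.
Proof. by rewrite tin_act linear0 bin_zero addr0. Qed.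

Lemma bin_vf M u (x : top M) :
  bin (bhom_fun (vf M x) u) = of_entries S (mor_mx 0 0 u 0) *: tin x.
Proof. by rewrite tin_act scale0r tin_zero add0r. Qed.

(** The restriction of a homomorphism to the tops, and below ([bmap]) to the
bottoms. *)
Section TopMap.
Variables (M N : lmodType S) (phi : {linear M -> N}).

Definition tmap_fun (x : top M) : top N := tout (phi (tin x)).

Lemma tmap_funE x : tin (tmap_fun x) = phi (tin x).
Proof.
by rewrite -idem1E -linearZ /= -[X in idem1 *: X]addr0 -bin_zero idem1_act.
Qed.

Fact tmap_linear : linear tmap_fun.
Proof.
move=> a x y; apply: tin_inj.
by rewrite tinD tinZ !tmap_funE tinD linearD tinZ linearZ.
Qed.

Definition tmap : {linear top M -> top N} := lin tmap_linear.

Lemma tmapE x : tin (tmap x) = phi (tin x).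
Proof. exact: tmap_funE. Qed.

End TopMap.

Lemma tmap_ses K M N (f : {linear K -> M}) (g : {linear M -> N}) :
  short_exact f g -> short_exact (tmap f) (tmap g).
Proof.
move=> [fI fE gS]; split=> [|x|z].
- by move=> x y e; apply/tin_inj/fI; rewrite -!tmapE e.
- split=> [e|[y <-]]; last first.
    by apply: tin_inj; rewrite !tmapE (exact0 _ fE) tin_zero.
  have [|m fm] := (fE (tin x)).1; first by rewrite -tmapE e tin_zero.
  exists (tout m); apply: tin_inj.
  by rewrite tmapE -idem1E linearZ /= fm idem1E tinK.
- have [m gm] := gS (tin z); exists (tout m); apply: tin_inj.
  by rewrite tmapE -idem1E linearZ /= gm idem1E tinK.
Qed.

End Corner.

Section Modules.
Variables (A B : pzRingType) (V : bimodType A B) (U : bimodType B A).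
Variable S : morita_view V U.
Implicit Types K M N P : lmodType S.

Definition bmap M N (phi : {linear M -> N}) : {linear bot M -> bot N} :=
  tmap (S := swap_view S) phi.

Lemma binZ M b (y : bot M) :
  bin (b *: y) = of_entries S (mor_mx 0 0 0 b) *: bin y.
Proof. exact: (tinZ (S := swap_view S)). Qed.

Lemma tin_vg M v (y : bot M) :
  tin (bhom_fun (vg M y) v) = of_entries S (mor_mx 0 v 0 0) *: bin y.
Proof. exact: (bin_vf (S := swap_view S)). Qed.

Lemma bmapE M N (phi : {linear M -> N}) y : bin (bmap phi y) = phi (bin y).
Proof. exact: (tmapE (S := swap_view S)). Qed.

Lemma bmap_ses K M N (f : {linear K -> M}) (g : {linear M -> N}) :
  short_exact f g -> short_exact (bmap f) (bmap g).
Proof. exact: (tmap_ses (S := swap_view S)). Qed.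

Lemma vf_natural M N (phi : {linear M -> N}) x u :
  bhom_fun (vf N (tmap phi x)) u = bmap phi (bhom_fun (vf M x) u).
Proof. by apply: bin_inj; rewrite bmapE !bin_vf tmapE linearZ. Qed.

Lemma vF_natural M N (phi : {linear M -> N}) t :
  vF N (tensor_map U (tmap phi) t) = bmap phi (vF M t).
Proof.
apply: (tensor_ext (f := lcomp (vF N) (tensor_map U (tmap phi)))
                   (g := lcomp (bmap phi) (vF M))) => u x /=.
by rewrite tensor_map_pure !vF_pure vf_natural.
Qed.

(** By [view_act] the action is the matrix action, so compatibility with the
structure maps is all that linearity over the Morita ring adds to linearity over
[A] and [B]. *)
Lemma pair_hom M N (a : {linear top M -> top N}) (b : {linear bot M -> bot N}) :
  (forall x u, bhom_fun (vf N (a x)) u = b (bhom_fun (vf M x) u)) ->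
  (forall y v, bhom_fun (vg N (b y)) v = a (bhom_fun (vg M y) v)) ->
  exists phi : {linear M -> N}, tmap phi =1 a /\ bmap phi =1 b.
Proof.
move=> ab ba; pose h (m : M) : N := tin (a (tout m)) + bin (b (bout m)).
have hE x y : h (tin x + bin y) = tin (a x) + bin (b y).
  by rewrite /h tout_split bout_split.
have hL : linear h.
  move=> l m m'; rewrite -(top_bot m) -(top_bot m').
  move: (tout m) (bout m) (tout m') (bout m') => x y x' y'.
  rewrite view_act addrACA -tinD -binD !hE view_act addrACA -tinD -binD.
  by congr (tin _ + bin _); rewrite !linearD !linearZ /= ?ab ?ba.
exists (lin hL); split=> [x|y].
- apply: tin_inj; rewrite tmapE /= -[tin x]addr0 -bin_zero hE linear0 bin_zero addr0.
  by [].
- apply: bin_inj; rewrite bmapE /= -[bin y]add0r -tin_zero hE linear0 tin_zero add0r.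
  by [].
Qed.

Lemma hom_ext M N (phi psi : {linear M -> N}) :
  tmap phi =1 tmap psi -> bmap phi =1 bmap psi -> phi =1 psi.
Proof.
move=> et eb m; rewrite -(top_bot m) !linearD -!tmapE -!bmapE.
by rewrite et eb.
Qed.

Lemma componentwise_ses K M N (f : {linear K -> M}) (g : {linear M -> N}) :
  short_exact (tmap f) (tmap g) -> short_exact (bmap f) (bmap g) ->
  short_exact f g.
Proof.
move=> [tI tE tS] [bI bE bS].
have split0 P (x : top P) (y : bot P) : tin x + bin y = 0 -> x = 0 /\ y = 0.
  by move=> e; apply: top_bot_inj; rewrite e tin_zero bin_zero addr0.
split=> [|m|n].
- apply: linear_inj => k; rewrite -(top_bot k) linearD -tmapE -bmapE.
  move=> /split0 [/(inj0 tI) -> /(inj0 bI) ->].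
  by rewrite tin_zero bin_zero addr0.
- split=> [|[k <-]].
    rewrite -(top_bot m) linearD -tmapE -bmapE => /split0 [].
    move=> /tE [x <-] /bE [y <-]; exists (tin x + bin y).
    by rewrite linearD tmapE bmapE.
  rewrite -(top_bot k) !linearD -!tmapE -!bmapE.
  by rewrite (exact0 _ tE) (exact0 _ bE) tin_zero bin_zero addr0.
- have [[x ex] [y ey]] := (tS (tout n), bS (bout n)).
  by exists (tin x + bin y); rewrite linearD -tmapE -bmapE ex ey top_bot.
Qed.

End Modules.

Section SwapModules.
Variables (A B : pzRingType) (V : bimodType A B) (U : bimodType B A).
Variables (S : morita_view V U) (M N : lmodType S) (phi : {linear M -> N}).

Lemma vg_natural y v :
  bhom_fun (vg N (bmap phi y)) v = tmap phi (bhom_fun (vg M y) v).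
Proof. exact: (vf_natural (S := swap_view S)). Qed.

Lemma vG_natural t :
  vG N (tensor_map V (bmap phi) t) = tmap phi (vG M t).
Proof. exact: (vF_natural (S := swap_view S)). Qed.

End SwapModules.

(** * Modules given by tuples *)

Section BhomE.
Variables (A B : pzRingType) (V : bimodType A B) (X : lmodType A).
Implicit Types h : bhom V X.

Lemma bhomDE h h' v : bhom_fun (h + h') v = bhom_fun h v + bhom_fun h' v.
Proof. by []. Qed.

Lemma bhomZE (b : B) h v : bhom_fun (b *: h) v = bhom_fun h (ract v b).
Proof. by []. Qed.

Lemma bhom0E v : bhom_fun (0 : bhom V X) v = 0.
Proof. by []. Qed.

End BhomE.

Section TupleModule.
Variables (A B : pzRingType) (V : bimodType A B) (U : bimodType B A).
Variable S : morita_view V U.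
Variables (X : lmodType A) (Y : lmodType B).
Variables (f : {linear X -> bhom U Y}) (g : {linear Y -> bhom V X}).

(** In the Morita ring the product of an entry from [V] and one from [U] is
zero. *)
Record tuple_law : Prop := TupleLaw {
  tuple_gf : forall x u v, bhom_fun (g (bhom_fun (f x) u)) v = 0;
  tuple_fg : forall y v u, bhom_fun (f (bhom_fun (g y) v)) u = 0
}.

Hypothesis law : tuple_law.

Definition tuple_sort of tuple_law : Type := (X * Y)%type.
Notation T := (tuple_sort law).

HB.instance Definition _ := GRing.Zmodule.on T.

Definition tuple_act (l : S) (p : T) : T :=
  ((entries l).1.1 *: p.1 + bhom_fun (g p.2) (entries l).1.2,
   bhom_fun (f p.1) (entries l).2.1 + (entries l).2.2 *: p.2).

Fact tuple_actA l l' p : tuple_act l (tuple_act l' p) = tuple_act (l * l') p.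
Proof.
rewrite /tuple_act entriesM.
move: (entries l) (entries l') p => [[a v] [u b]] [[a' v'] [u' b']] [x y] /=.
congr (_, _).
  rewrite !linearD !bhomDE tuple_gf // add0r linearZ bhomZE.
  by rewrite scalerDr scalerA linearZ addrA.
rewrite !linearD !bhomDE tuple_fg // addr0 linearZ bhomZE.
by rewrite scalerDr scalerA linearZ addrA.
Qed.

Fact tuple_act1 : left_id 1 tuple_act.
Proof.
by case=> x y; rewrite /tuple_act entries1 /= !linear0 !scale1r addr0 add0r.
Qed.

Fact tuple_actDr : right_distributive tuple_act +%R.
Proof.
move=> l [x y] [x' y']; rewrite /tuple_act /= !scalerDr !linearD !bhomDE.
by apply: congr2; apply: addrACA.
Qed.

Fact tuple_actDl p : {morph tuple_act^~ p : l l' / l + l'}.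
Proof.
move=> l l'; rewrite /tuple_act entriesD /= !scalerDl !linearD.
by apply: congr2; apply: addrACA.
Qed.

HB.instance Definition _ := GRing.Zmodule_isLmodule.Build S T
  tuple_actA tuple_act1 tuple_actDr tuple_actDl.

Lemma tuple_module_ex : exists (M : lmodType S) (a : {linear X -> top M})
    (b : {linear Y -> bot M}), [/\ bijective a, bijective b,
    forall x u, bhom_fun (vf M (a x)) u = b (bhom_fun (f x) u)
  & forall y v, bhom_fun (vg M (b y)) v = a (bhom_fun (g y) v)].
Proof.
pose M : lmodType S := T.
have actE l (x : X) (y : Y) : l *: ((x, y) : M) = tuple_act l (x, y) by [].
have aP x : tin (tout ((x, 0) : M)) = (x, 0).
  rewrite -idem1E actE /tuple_act entriesK /= !linear0.
  by rewrite scale1r scale0r !addr0.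
have bP y : bin (bout ((0, y) : M)) = (0, y).
  have := top_bot ((0, y) : M); rewrite -idem1E actE /tuple_act entriesK /=.
  by rewrite !linear0 scaler0 scale0r !addr0 => e; rewrite -[LHS]add0r; exact: e.
have aL : linear (fun x => tout ((x, 0) : M)).
  move=> c x x'; apply: tin_inj; rewrite tinD tinZ !aP actE /tuple_act entriesK /=.
  rewrite !linear0 !(scaler0, addr0, add0r).
  by rewrite -[RHS]/(c *: x + x', 0 + 0) addr0.
have bL : linear (fun y => bout ((0, y) : M)).
  move=> c y y'; apply: bin_inj; rewrite binD binZ !bP actE /tuple_act entriesK /=.
  rewrite !linear0 !(scaler0, addr0, add0r).
  by rewrite -[RHS]/(0 + 0, c *: y + y') addr0.
exists M, (lin aL), (lin bL); split=> [||x u|y v].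
- apply: inj_surj_bij => [x x' e|z].
    by have := aP x; rewrite [tout _]e aP => -[].
  pose p : X * Y := tin z; exists p.1; apply: tin_inj; rewrite /= aP.
  have e := idem1E (tin z); rewrite tinK in e.
  rewrite -e [tin z](surjective_pairing p).
  rewrite actE /tuple_act entriesK /= !linear0.
  by rewrite scale1r scale0r !addr0.
- apply: inj_surj_bij => [y y' e|z].
    by have := bP y; rewrite [bout _]e bP => -[].
  pose p : X * Y := bin z; exists p.2; apply: bin_inj; rewrite /= bP.
  have ez : bin z = ((p.1, p.2) : M) := surjective_pairing p.
  have : idem1 S *: bin z = 0 by rewrite -[bin z]add0r -{1}tin_zero idem1_act tin_zero.
  rewrite ez actE /tuple_act entriesK /= scale1r linear0.
  by rewrite addr0 => -[->].
- apply: bin_inj; rewrite bin_vf /= aP bP actE /tuple_act entriesK /=.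
  by rewrite !linear0 !(scale0r, scaler0, addr0, add0r).
- apply: tin_inj; rewrite tin_vg /= aP bP actE /tuple_act entriesK /=.
  by rewrite !linear0 !(scale0r, scaler0, addr0, add0r).
Qed.

End TupleModule.

(** * Inflated, induced and coinduced modules *)

Lemma ses_iso (R : pzRingType) (K L M K' L' M' : lmodType R)
    (f : {linear K -> L}) (g : {linear L -> M})
    (f' : {linear K' -> L'}) (g' : {linear L' -> M'})
    (a : {linear K -> K'}) (b : {linear L -> L'}) (c : {linear M -> M'}) :
  bijective a -> bijective b -> bijective c ->
  (forall x, f' (a x) = b (f x)) -> (forall y, g' (b y) = c (g y)) ->
  short_exact f g -> short_exact f' g'.
Proof.
move=> ab bb cb fE gE [fI fg gS].
have [[aS bS] cS] := (bij_surj ab, bij_surj bb, bij_surj cb).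
split=> [|y'|z'].
- apply: linear_inj => x'; have [x <-] := aS x'; rewrite fE.
  by move=> /(inj0 (bij_inj bb)) /(inj0 fI) ->; rewrite linear0.
- have [y <-] := bS y'; rewrite gE; split=> [/(inj0 (bij_inj cb)) /fg [x <-]|].
    by exists (a x).
  move=> [x']; have [x <-] := aS x'; rewrite fE => /(bij_inj bb) <-.
  by rewrite (exact0 _ fg) linear0.
- have [z <-] := cS z'; have [y <-] := gS z.
  by exists (b y).
Qed.

Section SpecialModules.
Variables (A B : pzRingType) (V : bimodType A B) (U : bimodType B A).
Variable S : morita_view V U.
Implicit Types (K M N P T H Z : lmodType S) (X Y W : lmodType A).

Lemma vg_vf M (x : top M) u v :
  bhom_fun (vg M (bhom_fun (vf M x) u)) v = 0.
Proof.
apply: tin_inj; rewrite tin_vg bin_vf scalerA -[tin x]addr0 -bin_zero view_act.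
rewrite entriesM !entriesK mor_mxM /= !(mul0r, scale0r, scaler0, ract0l, ract0r).
by rewrite !linear0 !addr0 !linear0 bin_zero tin_zero addr0.
Qed.

Lemma vg_vF M (t : tensor U (top M)) v : bhom_fun (vg M (vF M t)) v = 0.
Proof.
suff : lcomp (vg M) (vF M) =1 lzero _ _ by move=> /(_ t) /= ->.
apply: tensor_ext => u x /=; rewrite vF_pure.
by apply: bhom_ext => w; apply: vg_vf.
Qed.

Lemma tmap_comp M N P (f : {linear M -> N}) (g : {linear N -> P}) x :
  tmap (lcomp g f) x = tmap g (tmap f x).
Proof. by apply: tin_inj; rewrite !tmapE. Qed.

(** The tuple [(X, 0)]. *)
Definition inflation X M (a : {linear X -> top M}) : Prop :=
  bijective a /\ trivial (bot M).

Lemma inflation_ex X : exists M (a : {linear X -> top M}), inflation a.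
Proof.
have [Y Y0] := trivial_ex B.
have law : tuple_law (lzero X (bhom U Y)) (lzero Y (bhom V X)) by split.
have [M [a [b [ab bb _ _]]]] := tuple_module_ex S law.
exists M, a; split=> // y; have [z <-] := bij_surj bb y.
by rewrite (Y0 z) linear0.
Qed.

(** The tuple [(X, Hom (V, X))]; by [coinduction_adjoint] it is the value at [X] of
the right adjoint of [top]. *)
Definition coinduction X M (a : {linear X -> top M})
    (b : {linear bhom V X -> bot M}) : Prop :=
  [/\ bijective a, bijective b, forall x, vf M (a x) = 0
    & forall h v, bhom_fun (vg M (b h)) v = a (bhom_fun h v)].

Lemma coinduction_ex X :
  exists M (a : {linear X -> top M}) (b : {linear bhom V X -> bot M}),
    coinduction a b.
Proof.
have law : tuple_law (lzero X (bhom U (bhom V X))) (lid (bhom V X)) by split.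
have [M [a [b [ab bb fE gE]]]] := tuple_module_ex S law.
exists M, a, b; split=> // x; apply: bhom_ext => u.
by rewrite fE linear0.
Qed.

Lemma coinduction_adjoint X H (a : {linear X -> top H}) b M
    (phi : {linear top M -> X}) : coinduction a b ->
  exists psi : {linear M -> H}, forall x, tmap psi x = a (phi x).
Proof.
move=> [_ _ a0 bE].
pose beta := lcomp b (lcomp (bhom_map V phi) (vg M)).
have [x u|y v|psi [psiE _]] := pair_hom (a := lcomp a phi) (b := beta).
- rewrite /= a0 -[LHS]/0; set h := bhom_map_fun _ _.
  suff -> : h = 0 by rewrite linear0.
  by apply: bhom_ext => v; rewrite /= vg_vf linear0.
- by rewrite /= bE.
- by exists psi.
Qed.

Lemma entries0 : entries (0 : S) = 0.
Proof. by apply: (addrI (entries (0 : S))); rewrite -entriesD !addr0. Qed.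

Lemma of_entries0 : of_entries S 0 = 0.
Proof. by rewrite -entries0 of_entriesK. Qed.

Lemma mor_mxE (x : morita0 V U) : mor_mx x.1.1 x.1.2 x.2.1 x.2.2 = x.
Proof. by case: x => [[? ?] [? ?]]. Qed.

Definition row_elt (p : A * V) : S := of_entries S (mor_mx p.1 p.2 0 0).

Lemma idem1M (x : S) :
  idem1 S * x = row_elt (entries x).1.
Proof.
apply: (can_inj (@of_entriesK _ _ _ _ S)); rewrite entriesM !entriesK.
rewrite -[entries x]mor_mxE mor_mxM /=.
by rewrite !(mul1r, scale1r, mul0r, scale0r, ract0l, addr0).
Qed.

(** The top of the free module of rank one consists of the matrices with second
row zero, so it is [A (+) V]; tops of free modules are direct sums of copies of
it. *)
Lemma top_free_vanish X i (I : choiceType) : ext_vanish X i V ->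
  ext_vanish X i (top (dsum I (mv_ring S)^o : lmodType S)).
Proof.
move=> vV; pose F : lmodType S := dsum I (mv_ring S)^o.
pose W : lmodType A := (A^o * V)%type.
have eP := extends_to_class X.
have vW : ext_vanish X i W.
  apply: (vanish_extension eP (f := linl A^o V) (g := snd)) vV.
    split=> [x y [] //|[x y]|y] /=; last by exists (0, y).
    by split=> [->|[z [_ <-]]] //; exists x.
  exact/(vanish_projective eP)/projective_regular.
have [s sE] : exists s : {linear top F -> dsum I W},
    forall x t, dcoord (s x) t = (entries (dcoord (tin x) t : S)).1.
  have /choice [s sE] : forall x : top F, exists d : dsum I W,
      dcoord d = fun t => (entries (dcoord (tin x) t : S)).1.
    move=> x; have [r [_ rP]] := covers_ex (tin x).
    apply: (dsum_mk (r := r)) => t nz; apply: rP; apply: contraNneq nz => ->.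
    by rewrite entries0.
  have sL : linear s.
    move=> c x y; apply: dsum_ext => t; rewrite dcoordP !sE tinD tinZ dcoordP.
    rewrite entriesD entriesM entriesK -[entries (dcoord (tin x) t)]mor_mxE.
    by rewrite mor_mxM /= !(mul0r, scale0r, ract0l, addr0).
  by exists (lin sL) => x t; rewrite /= sE.
have [r rE] : exists r : {linear dsum I W -> top F}, forall d t,
    dcoord (tin (r d)) t = row_elt (dcoord d t).
  have /choice [r rE] : forall d : dsum I W, exists x : F, dcoord x =
      fun t => row_elt (dcoord d t).
    move=> d; have [r [_ rP]] := covers_ex d.
    apply: (dsum_mk (r := r)) => t nz; apply: rP; apply: contraNneq nz => ->.
    by rewrite /row_elt of_entries0.
  have rtE d : tin (tout (r d)) = r d.
    rewrite -idem1E; apply: dsum_ext => t; rewrite rE.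
    by rewrite -[LHS]/(idem1 S * dcoord (r d) t) rE idem1M entriesK.
  have rL : linear (fun d => tout (r d)).
    move=> c d d'; apply: tin_inj; rewrite tinD tinZ !rtE.
    apply: dsum_ext => t; rewrite dcoordP !rE.
    apply: (can_inj (@of_entriesK _ _ _ _ S)); rewrite entriesD entriesM !entriesK.
    by rewrite mor_mxM dcoordP mor_mxD /= !(scaler0, ract0l, scale0r, mul0r, mulr0, addr0).
  by exists (lin rL) => d t; rewrite /= rtE rE.
apply: (vanish_retract eP (s := s) (r := r)); last exact: ext_vanish_dsum.
move=> x; apply: tin_inj; apply: dsum_ext => t; rewrite rE sE.
rewrite -idem1M -[RHS]/(dcoord (tin x) t).
by rewrite -{2}[x]tinK -idem1E.
Qed.

End SpecialModules.

Section ExtTransfer.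
Variables (A B : pzRingType) (V : bimodType A B) (U : bimodType B A).
Variable S : morita_view V U.
Implicit Types (K M N P T H Z : lmodType S) (X Y W : lmodType A).

(** Both sides are computed by induction on the syzygies of [M].  Their tops are
syzygies of [top M] up to modules that are acyclic by [top_free_vanish], and in
the lowest degree the adjunction translates one extension problem into the
other. *)
Lemma coinduction_ext n X H (a : {linear X -> top H}) b i M :
  coinduction a b -> (forall j, (j < n)%N -> ext_vanish X j V) -> (i < n)%N ->
  ext_vanish H i M -> ext_vanish X i (top M).
Proof.
move=> co vV; have [ab _ _ _] := co.
have [a' [aK a'K]] := bijective_lin (bij_inj ab) (bij_surj ab).
have eP := extends_to_class X.
elim: i M => [|i IH] M lin vH; have [g gS] := free_cover_surj M;
  have [K [k [kI kE]]] := kernel_ex g;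
  have kg : short_exact k g by [].
  apply: (vanish0_cokernel eP (tmap_ses kg)); last exact/top_free_vanish/vV.
  move=> h; have [psi psiE] := coinduction_adjoint h co.
  have [psi' psi'E] := vH _ _ _ _ kg psi.
  exists (lcomp a' (tmap psi')) => x; rewrite -[LHS]/(a' (tmap psi' (tmap k x))).
  rewrite -tmap_comp -(aK (h x)) -psiE; congr (a' _).
  by apply: tin_inj; rewrite !tmapE /= psi'E.
have vK : ext_vanish H i K by apply: (vH _ _ k g) => //; apply: free_cover_projective.
apply: (vanish_cokernel eP (tmap_ses kg)); last exact/top_free_vanish/vV.
by apply: IH => //; apply: ltnW.
Qed.

(** The tuple [(X, U (x) X)]; by [induction_adjoint] and [induction_hom_ext] it is
the value at [X] of the left adjoint of [top]. *)
Definition induction X M (a : {linear X -> top M})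
    (b : {linear tensor U X -> bot M}) : Prop :=
  [/\ bijective a, bijective b,
      forall x u, bhom_fun (vf M (a x)) u = b (pure u x)
    & forall y, vg M y = 0].

Fact unit_linear_arg X (x : X) : linear (fun u : U => pure u x).
Proof. by move=> c u u'; rewrite pureDl pureZ. Qed.

Definition tensor_unit_fun X (x : X) : bhom U (tensor U X) :=
  lin (@unit_linear_arg X x).

Fact tensor_unit_linear X : linear (@tensor_unit_fun X).
Proof.
move=> a x y; apply: bhom_ext => u.
by rewrite bhomDE bhomZE /= pureDr pure_bal.
Qed.

Definition tensor_unit X : {linear X -> bhom U (tensor U X)} :=
  lin (@tensor_unit_linear X).

Lemma induction_ex X :
  exists M (a : {linear X -> top M}) (b : {linear tensor U X -> bot M}),
    induction a b.
Proof.
have law : tuple_law (tensor_unit X) (lzero (tensor U X) (bhom V X)).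
  by split=> // y v u; rewrite bhom0E linear0.
have [M [a [b [ab bb fE gE]]]] := tuple_module_ex S law.
exists M, a, b; split=> // y.
have [t <-] := bij_surj bb y; apply: bhom_ext => v.
by rewrite gE linear0.
Qed.

Lemma induction_vF X M (a : {linear X -> top M}) b t :
  induction a b -> b t = vF M (tensor_map U a t).
Proof.
move=> [_ _ fE _].
apply: (tensor_ext (f := b) (g := lcomp (vF M) (tensor_map U a))) => u x.
by rewrite /= tensor_map_pure vF_pure fE.
Qed.

Lemma induction_hom_ext X T (a : {linear X -> top T}) b M
    (phi psi : {linear T -> M}) : induction a b ->
  (forall x, tmap phi (a x) = tmap psi (a x)) -> phi =1 psi.
Proof.
move=> ind e; have [ab bb _ _] := ind.
have et : tmap phi =1 tmap psi.
  by move=> x; have [z <-] := bij_surj ab x.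
apply: hom_ext => // y; have [t <-] := bij_surj bb y.
rewrite (induction_vF t ind) -!vF_natural; congr (vF M _).
apply: (tensor_ext (f := tensor_map U (tmap phi)) (g := tensor_map U (tmap psi))).
by move=> u x; rewrite !tensor_map_pure et.
Qed.

Lemma induction_adjoint X T (a : {linear X -> top T}) b M
    (phi : {linear X -> top M}) : induction a b ->
  exists psi : {linear T -> M}, forall x, tmap psi (a x) = phi x.
Proof.
move=> ind; have [ab bb fE g0] := ind.
have [a' [aK a'K]] := bijective_lin (bij_inj ab) (bij_surj ab).
have [b' [bK b'K]] := bijective_lin (bij_inj bb) (bij_surj bb).
pose beta := lcomp (lcomp (vF M) (tensor_map U phi)) b'.
have [x u|y v|psi [psiE _]] := pair_hom (a := lcomp phi a') (b := beta).
- rewrite -{2}(a'K x) fE /= bK.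
  by rewrite [X in _ = vF M X](tensor_map_pure phi) vF_pure.
- by rewrite g0 bhom0E linear0 /= vg_vF.
- by exists psi => x; rewrite psiE /= aK.
Qed.

Lemma induction_map (K W : lmodType A) (TK TW : lmodType S)
    (aK : {linear K -> top TK}) bK (aW : {linear W -> top TW}) bW (f : {linear K -> W}) :
  induction aK bK -> induction aW bW ->
  exists phi : {linear TK -> TW},
    (forall x, tmap phi (aK x) = aW (f x)) /\
    (forall t, bmap phi (bK t) = bW (tensor_map U f t)).
Proof.
move=> iK iW; have [phi phiE] := induction_adjoint (lcomp aW f) iK.
exists phi; split=> // t.
rewrite (induction_vF t iK) (induction_vF _ iW) -vF_natural; congr (vF TW _).
by rewrite -!(tensor_map_comp (h := lcomp aW f)).
Qed.

Lemma induction_ses (K W X : lmodType A) (TK TW TX : lmodType S)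
    (aK : {linear K -> top TK}) bK (aW : {linear W -> top TW}) bW (aX : {linear X -> top TX}) bX
    (f : {linear K -> W}) (g : {linear W -> X}) :
  induction aK bK -> induction aW bW -> induction aX bX ->
  short_exact f g -> tor_vanish U 0 X ->
  exists (f' : {linear TK -> TW}) (g' : {linear TW -> TX}),
    short_exact f' g' /\ forall x, tmap f' (aK x) = aW (f x).
Proof.
move=> iK iW iX fg vX.
have [f' [f'a f'b]] := induction_map f iK iW.
have [g' [g'a g'b]] := induction_map g iW iX.
exists f', g'; split=> //; have [[aKb bKb _ _] [aWb bWb _ _] [aXb bXb _ _]] := And3 iK iW iX.
apply: componentwise_ses; first exact: (ses_iso aKb aWb aXb).
exact: (ses_iso bKb bWb bXb f'b g'b (tor_vanish_ses fg vX)).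
Qed.

(** A left adjoint of an exact functor preserves projectives. *)
Lemma induction_projective W T (a : {linear W -> top T}) b :
  induction a b -> projective W -> projective T.
Proof.
move=> ind Wp M N g h gS.
have tgS : surjective (tmap g).
  move=> z; have [m gm] := gS (tin z); exists (tout m); apply: tin_inj.
  by rewrite tmapE -idem1E linearZ /= gm idem1E tinK.
have [k kE] := Wp _ _ (tmap g) (lcomp (tmap h) a) tgS.
have [psi psiE] := induction_adjoint k ind.
exists psi => x; apply: (induction_hom_ext (phi := lcomp g psi) ind) => w.
by rewrite tmap_comp psiE kE.
Qed.

(** By the vanishing of Tor, a projective presentation of [X] induces one of [T],
whose syzygy is induced from the syzygy of [X]. *)
Lemma induction_ext i X T (a : {linear X -> top T}) b (N : lmodType A) Z
    (c : {linear N -> top Z}) : induction a b -> bijective c ->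
  (forall j, (j <= i)%N -> tor_vanish U j X) ->
  ext_vanish Z i T -> ext_vanish N i X.
Proof.
move=> ind cb; have [c' [cK c'K]] := bijective_lin (bij_inj cb) (bij_surj cb).
have eP := extends_to_class N.
elim: i X T a b ind => [|i IH] X T a b ind vX vZ;
  have [K [P [f [g [Pp fg]]]]] := presentation_ex X;
  have [TK [aK [bK iK]]] := induction_ex K;
  have [TP [aP [bP iP]]] := induction_ex P;
  have [f' [g' [fg' f'a]]] := induction_ses iK iP ind fg (vX 0 isT).
  apply: (vanish0_presentation eP Pp fg) => h.
  have [psi psiE] := induction_adjoint (lcomp c h) iK.
  have [psi' psi'E] := vZ _ _ _ _ fg' psi.
  exists (lcomp c' (lcomp (tmap psi') aP)) => x.
  rewrite -[LHS]/(c' (tmap psi' (aP (f x)))).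
  rewrite -f'a -tmap_comp -(cK (h x)) -[c (h x)]psiE; congr (c' _).
  by apply: tin_inj; rewrite !tmapE /= psi'E.
apply: (vanish_syzygy eP Pp fg); apply: (IH _ _ _ _ iK) => [j ji|].
  exact: (vX j.+1 ji _ _ f g).
by apply: (vZ _ _ f' g') => //; apply: induction_projective iP Pp.
Qed.

End ExtTransfer.

(** * Kernels and cokernels of the structure maps *)

Section StructureMaps.
Variables (A B : pzRingType) (V : bimodType A B) (U : bimodType B A).
Variable S : morita_view V U.
Variables (K M N : lmodType S) (phi : {linear K -> M}) (psi : {linear M -> N}).
Hypothesis ses : short_exact phi psi.

Lemma bhom_map0P (W Z : lmodType B) (h : {linear W -> Z}) (x : bhom U W) :
  bhom_map U h x = 0 <-> forall u, h (bhom_fun x u) = 0.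
Proof.
split=> [e u|e]; last by apply: bhom_ext => u; apply: e.
by have := congr1 (fun k => bhom_fun k u) e.
Qed.

(** Only surjectivity of [p] uses the exactness condition on [K].  If
[x] in [top M] maps into [Ker f_N], then [f_M x] takes values in the bottom of [K],
so it is a map [U -> bot K] killed by [g_K], hence of the form [f_K x'], and
[x - x'] lies in [Ker f_M]. *)
Lemma kernels_ses (KK KM KN : lmodType A) (kK : {linear KK -> top K})
    (kM : {linear KM -> top M}) (kN : {linear KN -> top N}) :
  injective kK -> exact kK (vf K) -> injective kM -> exact kM (vf M) ->
  injective kN -> exact kN (vf N) -> exact (vf K) (bhom_map U (vg K)) ->
  exists (i : {linear KK -> KM}) (p : {linear KM -> KN}),
    [/\ short_exact i p, forall x, kM (i x) = tmap phi (kK x)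
      & forall x, kN (p x) = tmap psi (kM x)].
Proof.
move=> kKI kKE kMI kME kNI kNE vfK.
have [tI tE tS] := tmap_ses ses; have [bI bE bS] := bmap_ses ses.
have [|i iE] := lift_mono (h := lcomp (tmap phi) kK) kMI.
  move=> x; apply/kME; apply: bhom_ext => u.
  by rewrite [LHS]vf_natural (exact0 _ kKE) bhom0E linear0.
have [|p pE] := lift_mono (h := lcomp (tmap psi) kM) kNI.
  move=> x; apply/kNE; apply: bhom_ext => u.
  by rewrite [LHS]vf_natural (exact0 _ kME) bhom0E linear0.
exists i, p; split=> //; split=> [|y|z].
- apply: linear_inj => x ix; apply: (inj0 kKI); apply: (inj0 tI).
  by rewrite -[LHS]iE ix linear0.
- split=> [py|[x <-]]; last first.
    apply: (inj0 kNI); rewrite pE -[LHS]/(tmap psi (kM (i x))) iE.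
    exact: (exact0 _ tE).
  have [|x xE] := (tE (kM y)).1; first by rewrite -[LHS]pE py linear0.
  have [|w wE] := (kKE x).1.
    apply: bhom_ext => u; apply: (inj0 bI).
    by rewrite -vf_natural xE (exact0 _ kME).
  by exists w; apply: kMI; rewrite iE -[LHS]/(tmap phi (kK w)) wE.
- have [x xE] := tS (kN z).
  have /choice [y yE] : forall u, exists y, bmap phi y = bhom_fun (vf M x) u.
    move=> u; apply/bE; rewrite -vf_natural xE.
    by rewrite (exact0 _ kNE).
  have yL : linear y.
    by move=> c u u'; apply: bI; rewrite linearP !yE linearP.
  have [|x' x'E] := (vfK (lin yL : bhom U (bot K))).1.
    apply/bhom_map0P => u; apply: bhom_ext => v; apply: (inj0 tI).
    rewrite -vg_natural -[LHS]/(bhom_fun (vg M (bmap phi (y u))) v) yE.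
    exact: vg_vf.
  have [|w wE] := (kME (x - tmap phi x')).1.
    apply: bhom_ext => u; rewrite linearB.
    rewrite -[LHS]/(bhom_fun (vf M x) u - bhom_fun (vf M (tmap phi x')) u).
    by rewrite vf_natural x'E -[X in _ - bmap phi X]/(y u) yE subrr.
  exists w; apply: kNI; rewrite pE -[LHS]/(tmap psi (kM w)) wE.
  by rewrite linearB xE (exact0 _ tE) subr0.
Qed.

(** A map [U -> bot N] killed by [g_N] has values in [Ker g_N]; it lifts to
[Ker g_M] by the vanishing of [Ext^1 (U, Ker g_K)], and there it is in the image of
[f_M]. *)
Lemma vf_exact (LK LM LN : lmodType B)
    (lM : {linear LM -> bot M}) (lN : {linear LN -> bot N})
    (i : {linear LK -> LM}) (p : {linear LM -> LN}) :
  exact lM (vg M) -> injective lN -> exact lN (vg N) ->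
  short_exact i p -> (forall x, lN (p x) = bmap psi (lM x)) ->
  ext_vanish LK 0 U -> exact (vf M) (bhom_map U (vg M)) ->
  exact (vf N) (bhom_map U (vg N)).
Proof.
move=> lME lNI lNE ip pE vU vfM h; have [_ _ tS] := tmap_ses ses.
split=> [/bhom_map0P h0|[x <-]]; last first.
  by apply/bhom_map0P => u; apply: bhom_ext => v; apply: vg_vf.
have [|h' h'E] := lift_mono (h := bhom_fun h) lNI.
  by move=> u; apply/lNE/h0.
have [k kE] := ext_vanish_lift h' ip vU.
have [|x xE] := (vfM (lcomp lM k : bhom U (bot M))).1.
  by apply/bhom_map0P => u; apply: (exact0 _ lME).
exists (tmap psi x); apply: bhom_ext => u.
by rewrite vf_natural xE -[LHS]/(bmap psi (lM (k u))) -pE kE h'E.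
Qed.

(** The cokernel for [K] is constructed as the kernel of the map between the other
two cokernels.  That [qK] kills no more than the image of [F_K] uses the exactness
condition on [N]: it corrects an element of [U (x) top M] by one of
[U (x) V (x) bot M] so that it vanishes over [N]. *)
Lemma cokernels_ses (QM QN : lmodType B) (qM : {linear bot M -> QM})
    (qN : {linear bot N -> QN}) :
  surjective qM -> exact (vF M) qM -> surjective qN -> exact (vF N) qN ->
  exact (tensor_map U (vG N)) (vF N) ->
  exists (QK : lmodType B) (qK : {linear bot K -> QK})
    (i : {linear QK -> QM}) (p : {linear QM -> QN}),
    [/\ surjective qK, exact (vF K) qK, short_exact i p,
        forall y, i (qK y) = qM (bmap phi y) & forall y, p (qM y) = qN (bmap psi y)].
Proof.
move=> qMS qME qNS qNE vFN.
have [tI tE tS] := tmap_ses ses; have [bI bE bS] := bmap_ses ses.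
have tU := tensor_right_exact (V := U) tE tS.
have tUS : surjective (tensor_map U (tmap psi)) by apply: tensor_map_surj.
have [|p pE] := descend_epi (h := lcomp qN (bmap psi)) qMS.
  by move=> y /qME [t <-]; rewrite -[LHS]/(qN (bmap psi (vF M t))) -vF_natural (exact0 _ qNE).
have pqM y : p (qM y) = qN (bmap psi y) by apply: pE.
have [QK [i [iI iE]]] := kernel_ex p.
have [|qK qKE] := lift_mono (h := lcomp qM (bmap phi)) iI.
  by move=> y; apply/iE; rewrite [p _]pqM (exact0 _ bE) linear0.
have iqK y : i (qK y) = qM (bmap phi y) by apply: qKE.
exists QK, qK, i, p; split=> //.
- move=> z; have [y yE] := qMS (i z).
  have [|t tE'] := (qNE (bmap psi y)).1; first by rewrite -pqM yE (exact0 _ iE).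
  have [s sE] := tUS t; have [|y' y'E] := (bE (y - vF M s)).1.
    by rewrite linearB -vF_natural sE tE' subrr.
  by exists y'; apply: iI; rewrite iqK y'E linearB yE (exact0 _ qME) subr0.
- move=> y; split=> [qy|[t <-]]; last first.
    by apply: iI; rewrite iqK -vF_natural (exact0 _ qME) linear0.
  have [|t tE'] := (qME (bmap phi y)).1; first by rewrite -iqK qy linear0.
  have [|w wE] := (vFN (tensor_map U (tmap psi) t)).1.
    by rewrite vF_natural tE' (exact0 _ bE).
  have [w' w'E] := tensor_map_surj (V := U) (tensor_map_surj (V := V) bS) w.
  have nat : tensor_map U (tmap psi) (tensor_map U (vG M) w') =
      tensor_map U (vG N) (tensor_map U (tensor_map V (bmap psi)) w').
    rewrite -!(tensor_map_comp (h := lcomp (tmap psi) (vG M))) // => x.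
    by rewrite vG_natural.
  have [|t' t'E] := (tU (t - tensor_map U (vG M) w')).1.
    by rewrite linearB nat w'E wE subrr.
  exists t'; apply: bI; rewrite -vF_natural t'E linearB tE'.
  suff -> : vF M (tensor_map U (vG M) w') = 0 by rewrite subr0.
  pose z : {linear tensor U (tensor V (bot M)) -> bot M} :=
    lcomp (vF M) (tensor_map U (vG M)).
  rewrite -[LHS]/(z w'); apply: (tensor_ext (g := lzero _ _)) => u x.
  rewrite /z [LHS]/= tensor_map_pure vF_pure.
  exact: (vg_vF (S := swap_view S)).
- split=> // z; have [y <-] := qNS z; have [y' <-] := bS y.
  by exists (qM y').
Qed.

(** The condition says that [G] induces an injection on [V (x) Coker F].  It passes
from [M] to [K] because [V (x) Coker F_K] embeds into [V (x) Coker F_M] by the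
vanishing of [Tor_1 (V, Coker F_N)]. *)
Lemma vG_exact (QK QM QN : lmodType B) (qK : {linear bot K -> QK})
    (qM : {linear bot M -> QM})
    (i : {linear QK -> QM}) (p : {linear QM -> QN}) :
  surjective qK -> exact (vF K) qK -> exact (vF M) qM -> short_exact i p ->
  (forall y, i (qK y) = qM (bmap phi y)) -> tor_vanish V 0 QN ->
  exact (tensor_map V (vF M)) (vG M) -> exact (tensor_map V (vF K)) (vG K).
Proof.
move=> qKS qKE qME ip iE vQ vGM x; have [tI _ _] := tmap_ses ses.
split=> [Gx|[w <-]]; last first.
  pose z := lcomp (vG K) (tensor_map V (vF K)).
  rewrite -[LHS]/(z w); apply: (tensor_ext (g := lzero _ _)) => v y.
  by rewrite /z [LHS]/= tensor_map_pure vG_pure; apply: vg_vF.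
apply/(tensor_right_exact (V := V) qKE qKS).
apply: (inj0 (vQ _ _ i p ip)).
rewrite -(tensor_map_comp (h := lcomp qM (bmap phi))) //.
rewrite (tensor_map_comp (f := bmap phi) (g := qM)) //.
have [|w <-] := (vGM (tensor_map V (bmap phi) x)).1.
  by rewrite vG_natural Gx linear0.
rewrite -(tensor_map_comp (h := lzero _ QM)) ?tensor_map0 // => y.
by rewrite (exact0 _ qME).
Qed.

End StructureMaps.

(** * Classes of modules in a view *)

Section Classes.
Variables (A B : pzRingType) (V : bimodType A B) (U : bimodType B A).
Variable S : morita_view V U.
Implicit Types (C : lmodType A -> Prop) (D : lmodType B -> Prop).
Implicit Types (K M N Z : lmodType S).

Definition view_U C D M : Prop := C (top M) /\ D (bot M).

Definition view_B C D M : Prop :=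
  [/\ cokernel_in (vF M) D, cokernel_in (vG M) C,
      exact (tensor_map V (vF M)) (vG M) & exact (tensor_map U (vG M)) (vF M)].

Definition view_J C D M : Prop :=
  [/\ kernel_in (vf M) C, kernel_in (vg M) D,
      exact (vf M) (bhom_map U (vg M)) & exact (vg M) (bhom_map V (vf M))].

Lemma top_trivial Z : trivial Z -> trivial (top Z).
Proof. by move=> Z0 x; apply: tin_inj; rewrite [LHS]Z0 tin_zero. Qed.

End Classes.

Section ZeroModules.
Variables (A B : pzRingType) (V : bimodType A B) (U : bimodType B A).

Lemma exact_trivial (R : pzRingType) (K M N : lmodType R) (f : {linear K -> M})
  (g : {linear M -> N}) : trivial M -> exact f g.
Proof.
move=> M0 y; rewrite (M0 y) linear0; split=> // _.
by exists 0; rewrite linear0.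
Qed.

Lemma bhom_trivial (X : lmodType A) : trivial X -> trivial (bhom V X).
Proof. by move=> X0 h; apply: bhom_ext => v; apply: X0. Qed.

Lemma tensor_trivial (Y : lmodType B) : trivial Y -> trivial (tensor V Y).
Proof.
by move=> Y0 x; rewrite -[x](tensor_map_id (h := lid Y)) // tensor_map0.
Qed.

Lemma kernel_in_trivial (R : pzRingType) (M N : lmodType R) (f : {linear M -> N})
    (C : lmodType R -> Prop) :
  (forall Z, trivial Z -> C Z) -> trivial M -> kernel_in f C.
Proof.
by move=> C0 M0; exists M, (lid M); split; [|exact: exact_trivial|exact: C0].
Qed.

Lemma cokernel_in_trivial (R : pzRingType) (M N : lmodType R) (f : {linear M -> N})
    (C : lmodType R -> Prop) :
  (forall Z, trivial Z -> C Z) -> trivial N -> cokernel_in f C.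
Proof.
move=> C0 N0; exists N, (lid N); split; [|exact: exact_trivial|exact: C0].
by move=> z; exists z.
Qed.

End ZeroModules.

Section ViewResolutions.
Variables (A B : pzRingType) (V : bimodType A B) (U : bimodType B A).
Variable S : morita_view V U.
Variables (n : nat) (C : lmodType A -> Prop) (D : lmodType B -> Prop).
Hypotheses (C0 : forall Z, trivial Z -> C Z) (D0 : forall Z, trivial Z -> D Z).
Implicit Types (K M N Z : lmodType S).

Lemma bot_trivial Z : trivial Z -> trivial (bot Z).
Proof. exact: (top_trivial (S := swap_view S)). Qed.

Lemma view_J_trivial Z : trivial Z -> view_J C D Z.
Proof.
move=> Z0; have [t0 b0] := (top_trivial Z0, bot_trivial Z0).
split; try exact: kernel_in_trivial; apply: exact_trivial; exact: bhom_trivial.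
Qed.

Lemma view_B_trivial Z : trivial Z -> view_B C D Z.
Proof.
move=> Z0; have [t0 b0] := (top_trivial Z0, bot_trivial Z0).
split; try exact: cokernel_in_trivial; apply: exact_trivial; exact: tensor_trivial.
Qed.

(** The kernels of the structure maps of the successive syzygies form resolutions
by [C] and [D]; the first obstruction group vanishes at every step because at most
[n] of them are taken. *)
Lemma resolved_view_J m N :
  (forall i X, (i < n)%N -> C X -> ext_vanish X i V) ->
  (forall i Y, (i < n)%N -> D Y -> ext_vanish Y i U) ->
  (forall X, C X -> D (bhom V X)) -> (forall Y, D Y -> C (bhom U Y)) ->
  (m <= n)%N -> resolved (view_J C D) m N ->
  view_J (resolved C m) (resolved D m) N.
Proof.
move=> CV DU CD DC; elim: m N => [|m IH] N mn /=.
  move=> N0; have [t0 b0] := (top_trivial N0, bot_trivial N0).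
  split; try exact: kernel_in_trivial; apply: exact_trivial; exact: bhom_trivial.
move=> [K [J [phi [psi [ses [[KJ [kJ [kJI kJE CKJ]]] [LJ [lJ [lJI lJE DLJ]]] fJ gJ]]]]]].
move=> /(IH K (ltnW mn)) [[KK [kK [kKI kKE CKK]]] [LK [lK [lKI lKE DLK]]] fK gK].
have [KN [kN [kNI kNE]]] := kernel_ex (vf N).
have [LN [lN [lNI lNE]]] := kernel_ex (vg N).
have [i [p [ip _ pE]]] := kernels_ses ses kKI kKE kJI kJE kNI kNE fK.
have [j [q [jq _ qE]]] :=
  kernels_ses (S := swap_view S) ses lKI lKE lJI lJE lNI lNE gK.
have [vK _] := resolved_bhom CV CD (ltnW mn) CKK.
have [vL _] := resolved_bhom DU DC (ltnW mn) DLK.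
split.
- exists KN, kN; split=> //.
  by exists KK, KJ, i, p.
- exists LN, lN; split=> //.
  by exists LK, LJ, j, q.
- exact: (vf_exact ses lJE lNI lNE jq qE (vL 0 mn) fJ).
- exact: (vf_exact (S := swap_view S) ses kJE kNI kNE ip pE (vK 0 mn) gJ).
Qed.

Lemma coresolved_view_B m N :
  (forall i X, (i < n)%N -> C X -> tor_vanish U i X) ->
  (forall i Y, (i < n)%N -> D Y -> tor_vanish V i Y) ->
  (forall Y, D Y -> C (tensor V Y)) -> (forall X, C X -> D (tensor U X)) ->
  (m <= n)%N -> coresolved (view_B C D) m N ->
  view_B (coresolved C m) (coresolved D m) N.
Proof.
move=> CU DV DC CD; elim: m N => [|m IH] N mn /=.
  move=> N0; have [t0 b0] := (top_trivial N0, bot_trivial N0).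
  split; try exact: cokernel_in_trivial; apply: exact_trivial; exact: tensor_trivial.
move=> [J [K [phi [psi [ses [[QJ [qJ [qJS qJE DQJ]]] [RJ [rJ [rJS rJE CRJ]]] gJ fJ]]]]]].
move=> /(IH K (ltnW mn)) [[QK [qK [qKS qKE DQK]]] [RK [rK [rKS rKE CRK]]] gK fK].
have [QN [qN [i [p [qNS qNE ip iE _]]]]] := cokernels_ses ses qJS qJE qKS qKE fK.
have [RN [rN [j [q [rNS rNE jq jE _]]]]] :=
  cokernels_ses (S := swap_view S) ses rJS rJE rKS rKE gK.
have [vQ _] := coresolved_tensor DV DC (ltnW mn) DQK.
have [vR _] := coresolved_tensor CU CD (ltnW mn) CRK.
split.
- exists QN, qN; split=> //.
  by exists QJ, QK, i, p.
- exists RN, rN; split=> //.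
  by exists RJ, RK, j, q.
- exact: (vG_exact ses qNS qNE qJE ip iE (vQ 0 mn) gJ).
- exact: (vG_exact (S := swap_view S) ses rNS rNE rJE jq jE (vR 0 mn) fJ).
Qed.

(** The image of [f] is the kernel of [Hom (U, g)], which is [Hom (U, Ker g)]; so
the top is an extension of [Hom (U, Ker g)] by [Ker f]. *)
Lemma view_J_top N : view_J C D N -> (forall Y, D Y -> C (bhom U Y)) ->
  closed_under_extensions C -> C (top N).
Proof.
move=> [[K [k [kI kE CK]]] [L [l [lI lE DL]]] fE _] DC ext.
have lUI : injective (bhom_map U l).
  apply: linear_inj => h /bhom_map0P h0; apply: bhom_ext => u.
  exact: (inj0 lI).
have lift (h : bhom U (bot N)) : bhom_map U (vg N) h = 0 ->
    exists h', bhom_map U l h' = h.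
  move=> /bhom_map0P h0; have [|h' h'E] := lift_mono (h := bhom_fun h) lI.
    by move=> u; apply/lE.
  by exists h'; apply: bhom_ext.
have [|t tE] := lift_mono (h := vf N) lUI.
  by move=> x; apply/lift/fE; exists x.
apply: (ext _ _ _ k t) CK (DC _ DL); split=> // [x|h].
  rewrite -(kE x) -tE; split=> [->|/(inj0 lUI) //].
  by rewrite linear0.
have [|x xE] := (fE (bhom_map U l h)).1.
  by apply/bhom_map0P => u; apply: (exact0 _ lE).
by exists x; apply: lUI; rewrite tE.
Qed.

(** The image of [G] is [V (x) Coker F], so the top is an extension of [Coker G] by
[V (x) Coker F]. *)
Lemma view_B_top N : view_B C D N -> (forall Y, D Y -> C (tensor V Y)) ->
  closed_under_extensions C -> C (top N).
Proof.
move=> [[Q [q [qS qE DQ]]] [R [r [rS rE CR]]] gE _] DC ext.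
have qV := tensor_right_exact (V := V) qE qS.
have qVS : surjective (tensor_map V q) by apply: tensor_map_surj.
have [|t tE] := descend_epi (h := vG N) qVS; first by move=> x /qV /gE.
apply: (ext _ _ _ t r) (DC _ DQ) CR; split=> // [|x].
  apply: linear_inj => z; have [x <-] := qVS z.
  by rewrite tE => /gE /qV.
split=> [/rE [x' <-]|[z <-]].
  by exists (tensor_map V q x').
by have [x' <-] := qVS z; rewrite tE (exact0 _ rE).
Qed.

End ViewResolutions.

(** * Cotorsion pairs at a corner *)

Section Halves.
Variables (A B : pzRingType) (V : bimodType A B) (U : bimodType B A).
Variable S : morita_view V U.
Implicit Types (K M N Z H T : lmodType S) (X : lmodType A) (Y : lmodType B).

(** A decomposition of [X] is one of the tuple [(X, 0)], whose bottom is in [D]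
because it is zero. *)
Lemma inflation_summands (C : lmodType A -> Prop) (D : lmodType B -> Prop) :
  module_class C -> module_class D ->
  closed_under_summands (view_U (S := S) C D) -> closed_under_summands C.
Proof.
move=> [_ Ciso] [D0 _] sum M N X h hB CX.
have [M' [a [aB M'0]]] := inflation_ex S M.
have [N' [b [bB N'0]]] := inflation_ex S N.
have [X' [c [cB X'0]]] := inflation_ex S X.
have [a' [aK a'K]] := bijective_lin (bij_inj aB) (bij_surj aB).
have [b' [bK b'K]] := bijective_lin (bij_inj bB) (bij_surj bB).
have [x u|y v|i [iE _]] := pair_hom
  (a := lcomp c (lcomp h (lcomp (linl M N) a'))) (b := lzero (bot M') (bot X')).
- by rewrite [LHS]X'0.
- by rewrite [bhom_fun _ _](_ : _ = 0) ?[y]M'0 !linear0 // bhom0E linear0.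
have [x u|y v|j [jE _]] := pair_hom
  (a := lcomp c (lcomp h (lcomp (linr M N) b'))) (b := lzero (bot N') (bot X')).
- by rewrite [LHS]X'0.
- by rewrite [bhom_fun _ _](_ : _ = 0) ?[y]N'0 !linear0 // bhom0E linear0.
have onlytop (P : lmodType S) : trivial (bot P) -> forall m : P, m = tin (tout m).
  by move=> P0 m; rewrite -[LHS]top_bot (P0 (bout m)) bin_zero addr0.
have ijE (m : M') (n : N') : i m + j n = tin (c (h (a' (tout m), b' (tout n)))).
  rewrite [m in LHS](onlytop _ M'0) [n in LHS](onlytop _ N'0) -!tmapE iE jE.
  rewrite -tinD /= -!linearD; congr (tin (c (h _))).
  by rewrite -[LHS]/(a' (tout m) + 0, 0 + b' (tout n)) addr0 add0r.
have [C'M _] : view_U (S := S) C D M'.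
  apply: (sum M' N' X' (lcopair i j)).
    apply: inj_surj_bij => [|x'].
      apply: linear_inj => -[m n]; rewrite [LHS]ijE -tin_zero => /tin_inj.
      move=> /(inj0 (bij_inj cB)) /(inj0 (bij_inj hB)) [].
      move=> /(inj0 (can_inj a'K)) m0 /(inj0 (can_inj b'K)) n0.
      by rewrite (onlytop _ M'0 m) (onlytop _ N'0 n) m0 n0 !tin_zero.
    have [x cx] := bij_surj cB (tout x'); have [[m n] hx] := bij_surj hB x.
    exists (tin (a m), tin (b n)); rewrite [LHS]ijE !tinK aK bK hx cx.
    by rewrite -(onlytop _ X'0).
  by split; [exact: (Ciso _ _ c cB) | exact: D0].
by apply: (Ciso _ _ a') C'M; exists a.
Qed.

(** For orthogonality, [X] is inflated and [Y] is coinduced: the components of the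
first are [X] and zero, and so are, with [Y] for [X], the kernels of the structure
maps of the second.  The approximation of [M] is the top of an approximation of
its inflation. *)
Lemma left_cotorsion_top n (C1 C2 : lmodType A -> Prop) (D1 D2 : lmodType B -> Prop) :
  (0 < n)%N ->
  module_class C1 -> module_class C2 -> module_class D1 -> module_class D2 ->
  left_cotorsion_pair n (view_U (S := S) C1 D1) (view_J (S := S) C2 D2) ->
  (forall i X, (i < n)%N -> C2 X -> ext_vanish X i V) ->
  (forall i Y, (i < n)%N -> D2 Y -> ext_vanish Y i U) ->
  (forall X, C2 X -> D2 (bhom V X)) -> (forall Y, D2 Y -> C2 (bhom U Y)) ->
  closed_under_extensions (wedge C2 n.-1) ->
  left_cotorsion_pair n C1 C2.
Proof.
case: n => // n _ C1c C2c D1c D2c [sum orth approx] CV DU CD DC ext.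
have [[C10 C1i] [C20 C2i] [D10 _] [D20 _]] := And4 C1c C2c D1c D2c.
split; first exact: (inflation_summands C1c D1c).
- case=> // i /andP [_ lin] X Y CX CY.
  have [X' [a [aB X'0]]] := inflation_ex S X.
  have [a' [aK a'K]] := bijective_lin (bij_inj aB) (bij_surj aB).
  have [Y' [b [c co]]] := coinduction_ex S Y.
  have UX' : view_U (S := S) C1 D1 X'.
    by split; [exact: (C1i _ _ a aB) | exact: D10].
  have JY' : view_J (S := S) C2 D2 Y'.
    have [bB cB b0 cE] := co.
    have f0 x : vf Y' x = 0 by have [y <-] := bij_surj bB x.
    have gI : injective (vg Y').
      apply: linear_inj => y; have [h <-] := bij_surj cB y => h0.
      suff -> : h = 0 by rewrite linear0.
      apply: bhom_ext => v; apply: (inj0 (bij_inj bB)).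
      by rewrite -cE h0 bhom0E.
    have gS : surjective (vg Y').
      move=> h; have [b' [bK b'K]] := bijective_lin (bij_inj bB) (bij_surj bB).
      exists (c (bhom_map V b' h)); apply: bhom_ext => v.
      by rewrite cE /= b'K.
    have [Z Z0] := trivial_ex B.
    split.
    + exists (top Y'), (lid _); split=> //; last exact: (C2i _ _ b).
      by move=> x; split=> _ //; exists x.
    + exists Z, (lzero Z (bot Y')); split; last exact: D20.
        by move=> x y _; rewrite [x]Z0 [y]Z0.
      move=> y; split=> [/(inj0 gI) ->|[x <-]]; last by rewrite linear0.
      by exists 0; rewrite linear0.
    + move=> h; split=> [/bhom_map0P h0|[x <-]]; last by rewrite f0 linear0.
      exists 0; rewrite linear0; apply: bhom_ext => u; apply: gI.
      by rewrite -[h]/(h : bhom U _) (h0 u) bhom0E linear0.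
    + move=> h; split=> [_|_]; first exact: gS.
      by apply: bhom_ext => v; apply: f0.
  have /Ext_eq0_vanish vX' := orth i.+1 lin X' Y' UX' JY'.
  have vX := coinduction_ext co (fun j jn => CV j Y jn CY) lin vX'.
  apply: vanish_Ext_eq0.
  exact: (vanish_retract (extends_to_class Y) (s := a) (r := a')) vX.
- move=> M; have [M' [a [aB _]]] := inflation_ex S M.
  have [a' [aK a'K]] := bijective_lin (bij_inj aB) (bij_surj aB).
  have [K [X [f [g [fg [CX _] wK]]]]] := approx M'.
  exists (top K), (top X), (tmap f), (lcomp a' (tmap g)).
  have a'B : bijective a' by exists a.
  have idB R (W : lmodType R) : bijective (lid W) by exists id.
  split=> //; first exact: (ses_iso (idB _ _) (idB _ _) a'B _ _ (tmap_ses fg)).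
  apply/(wedge_resolved C20).
  have /wedge_resolved rK := wK.
  have JK := resolved_view_J CV DU CD DC (leqnn _) (rK (view_J_trivial C20 D20)).
  apply: (view_J_top JK) => [Y DY|].
    by have [] := resolved_bhom DU DC (leqnn _) DY.
  move=> P Q R p q pq /(wedge_resolved C20) CP /(wedge_resolved C20) CR.
  exact/(wedge_resolved C20)/(ext _ _ _ _ _ pq).
Qed.

(** Dually, [X] is induced and [Y] is inflated. *)
Lemma right_cotorsion_top n (C1 C2 : lmodType A -> Prop) (D1 D2 : lmodType B -> Prop) :
  (0 < n)%N ->
  module_class C1 -> module_class C2 -> module_class D1 -> module_class D2 ->
  right_cotorsion_pair n (view_B (S := S) C1 D1) (view_U (S := S) C2 D2) ->
  (forall i X, (i < n)%N -> C1 X -> tor_vanish U i X) ->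
  (forall i Y, (i < n)%N -> D1 Y -> tor_vanish V i Y) ->
  (forall Y, D1 Y -> C1 (tensor V Y)) -> (forall X, C1 X -> D1 (tensor U X)) ->
  closed_under_extensions (vee C1 n.-1) ->
  right_cotorsion_pair n C1 C2.
Proof.
case: n => // n _ C1c C2c D1c D2c [sum orth approx] CU DV DC CD ext.
have [[C10 C1i] [C20 C2i] [D10 _] [D20 _]] := And4 C1c C2c D1c D2c.
split; first exact: (inflation_summands C2c D2c).
- case=> // i /andP [_ lin] X Y CX CY.
  have [Y' [c [cB Y'0]]] := inflation_ex S Y.
  have [T [a [b ind]]] := induction_ex S X.
  have UY' : view_U (S := S) C2 D2 Y'.
    by split; [exact: (C2i _ _ c cB) | exact: D20].
  have BT : view_B (S := S) C1 D1 T.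
    have [aB bB fE g0] := ind.
    have G0 t : vG T t = 0.
      apply: (tensor_ext (f := vG T) (g := lzero _ _)) => v y.
      by rewrite vG_pure g0.
    have FI : injective (tensor_map U a) -> injective (vF T).
      move=> aI; apply: linear_inj => t.
      have [s <-] := tensor_map_surj (V := U) (bij_surj aB) t.
      by rewrite -(induction_vF s ind) => /(inj0 (bij_inj bB)) ->; rewrite linear0.
    have aI : injective (tensor_map U a).
      have [a' [aK a'K]] := bijective_lin (bij_inj aB) (bij_surj aB).
      apply: (can_inj (g := tensor_map U a')) => t.
      by rewrite -(tensor_map_comp (h := lid X)) ?tensor_map_id.
    have FS : surjective (vF T).
      move=> y; have [s <-] := bij_surj bB y.
      by exists (tensor_map U a s); rewrite -(induction_vF s ind).
    have [Z Z0] := trivial_ex B.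
    split.
    + exists Z, (lzero (bot T) Z); split; last exact: D10.
        by move=> z; exists 0; rewrite [LHS]Z0 [z]Z0.
      by move=> y; split=> // _; apply: FS.
    + exists (top T), (lid _); split; last exact: (C1i _ _ a).
        by move=> z; exists z.
      by move=> x; split=> [/= ->|[t <-]]; [exists 0; rewrite linear0 | rewrite G0].
    + move=> t; split=> [_|[s <-]]; last exact: G0.
      exact: tensor_map_surj.
    + move=> t; split=> [/(inj0 (FI aI)) ->|[s <-]]; first by exists 0; rewrite linear0.
      by rewrite tensor_map0 ?linear0.
  have /Ext_eq0_vanish vT := orth i.+1 lin T Y' BT UY'.
  apply: vanish_Ext_eq0; apply: (induction_ext ind cB _ vT) => j ji.
  by apply: CU => //; apply: leq_ltn_trans lin.
- move=> M; have [M' [a [aB _]]] := inflation_ex S M.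
  have [X [K [f [g [fg [CX _] wK]]]]] := approx M'.
  exists (top X), (top K), (lcomp (tmap f) a), (tmap g).
  have [a' [aK a'K]] := bijective_lin (bij_inj aB) (bij_surj aB).
  have a'B : bijective a' by exists a.
  have idB R (W : lmodType R) : bijective (lid W) by exists id.
  split=> //.
    apply: (ses_iso a'B (idB _ _) (idB _ _) _ _ (tmap_ses fg)) => // x.
    by rewrite -[LHS]/(tmap f (a (a' x))) a'K.
  apply/(vee_coresolved C10).
  have /vee_coresolved rK := wK.
  have BK := coresolved_view_B CU DV DC CD (leqnn _) (rK (view_B_trivial C10 D10)).
  apply: (view_B_top BK) => [Y DY|].
    by have [] := coresolved_tensor DV DC (leqnn _) DY.
  move=> P Q R p q pq /(vee_coresolved C10) CP /(vee_coresolved C10) CR.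
  exact/(vee_coresolved C10)/(ext _ _ _ _ _ pq).
Qed.

End Halves.

(** The classes of the theorem, seen from the bottom corner. *)
Lemma class_U_swap (A B : pzRingType) (V : bimodType A B) (U : bimodType B A)
    (C : lmodType A -> Prop) (D : lmodType B -> Prop) :
  class_U V U C D = view_U (S := swap_view (std_view V U)) D C.
Proof. by apply/funext => M; apply/propext; split=> -[]. Qed.

Lemma class_J_swap (A B : pzRingType) (V : bimodType A B) (U : bimodType B A)
    (C : lmodType A -> Prop) (D : lmodType B -> Prop) :
  class_J V U C D = view_J (S := swap_view (std_view V U)) D C.
Proof. by apply/funext => M; apply/propext; split=> -[]. Qed.

Lemma class_B_swap (A B : pzRingType) (V : bimodType A B) (U : bimodType B A)
    (C : lmodType A -> Prop) (D : lmodType B -> Prop) :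
  class_B V U C D = view_B (S := swap_view (std_view V U)) D C.
Proof. by apply/funext => M; apply/propext; split=> -[]. Qed.

Theorem proposition4p12 (A B : pzRingType)
  (V : bimodType A B) (U : bimodType B A) (n : nat)
  (C1 C2 : lmodType A -> Prop) (D1 D2 : lmodType B -> Prop) :
  (1 <= n)%N ->
  module_class C1 -> module_class C2 -> module_class D1 -> module_class D2 ->
  (left_cotorsion_pair n (class_U V U C1 D1) (class_J V U C2 D2) ->
   (forall i, (1 <= i <= n)%N ->
      (forall X : lmodType A, C2 X -> Ext_eq0 i V X) /\
      (forall Y : lmodType B, D2 Y -> Ext_eq0 i U Y)) ->
   (forall (X : lmodType A) (Y : lmodType B), C2 X -> D2 Y ->
      Ext_eq0 1 (bhom U Y) X) ->
   (forall (X : lmodType A) (Y : lmodType B), C2 X -> D2 Y ->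
      Ext_eq0 1 (bhom V X) Y) ->
   (forall X : lmodType A, C2 X -> D2 (bhom V X)) ->
   (forall Y : lmodType B, D2 Y -> C2 (bhom U Y)) ->
   closed_under_extensions (wedge C2 n.-1) ->
   closed_under_extensions (wedge D2 n.-1) ->
   left_cotorsion_pair n C1 C2 /\ left_cotorsion_pair n D1 D2)
  /\
  (right_cotorsion_pair n (class_B V U C1 D1) (class_U V U C2 D2) ->
   (forall i, (1 <= i <= n)%N ->
      (forall X : lmodType A, C1 X -> Tor_eq0 i U X) /\
      (forall Y : lmodType B, D1 Y -> Tor_eq0 i V Y)) ->
   (forall (X : lmodType A) (Y : lmodType B), C1 X -> D1 Y ->
      Ext_eq0 1 X (tensor V Y)) ->
   (forall (X : lmodType A) (Y : lmodType B), C1 X -> D1 Y ->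
      Ext_eq0 1 Y (tensor U X)) ->
   (forall Y : lmodType B, D1 Y -> C1 (tensor V Y)) ->
   (forall X : lmodType A, C1 X -> D1 (tensor U X)) ->
   closed_under_extensions (vee C1 n.-1) ->
   closed_under_extensions (vee D1 n.-1) ->
   right_cotorsion_pair n C1 C2 /\ right_cotorsion_pair n D1 D2).
Proof.
move=> n0 C1c C2c D1c D2c; split.
  move=> pair extV _ _ CD DC extC extD.
  have CV i X : (i < n)%N -> C2 X -> ext_vanish X i V.
    by move=> lin CX; apply: Ext_eq0_vanish; apply: (extV i.+1 _).1.
  have DU i Y : (i < n)%N -> D2 Y -> ext_vanish Y i U.
    by move=> lin DY; apply: Ext_eq0_vanish; apply: (extV i.+1 _).2.
  split; first exact: (left_cotorsion_top (S := std_view V U) n0 C1c C2c D1c D2c pair).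
  rewrite class_U_swap class_J_swap in pair.
  exact: (left_cotorsion_top (S := swap_view (std_view V U)) n0 D1c D2c C1c C2c pair).
move=> pair torV _ _ DC CD extC extD.
have CU i X : (i < n)%N -> C1 X -> tor_vanish U i X.
  by move=> lin CX; apply: Tor_eq0_vanish; apply: (torV i.+1 _).1.
have DV i Y : (i < n)%N -> D1 Y -> tor_vanish V i Y.
  by move=> lin DY; apply: Tor_eq0_vanish; apply: (torV i.+1 _).2.
split; first exact: (right_cotorsion_top (S := std_view V U) n0 C1c C2c D1c D2c pair).
rewrite class_U_swap class_B_swap in pair.
exact: (right_cotorsion_top (S := swap_view (std_view V U)) n0 D1c D2c C1c C2c pair).
Qed.
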